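(* Fix an integer $k\ge1$. For $n\ge1$ let $\mathcal{P}_n=\mathcal{P}(2k+1,\ldots,2k+1)$ be the pretzel link with $n$ tangles, each consisting of $2k+1$ crossings. Then $M(V_{\mathcal{P}_n}(t))\to\infty$ as $n\to\infty$.
   Context: $\mathcal{P}(a_1,\ldots,a_n)$ denotes the pretzel link formed by $n$ vertical twist regions (two-strand twist tangles) with $a_1,\ldots,a_n$ half-twists placed side by side and connected in the standard cyclic way; $\mathcal{P}_n$ is a knot if $n$ is odd and a two-component link if $n$ is even. $V_L(t)$ is the Jones polynomial, and $M$ is the Mahler measure $M(f)=\exp\int_0^1\log|f(e^{2\pi i\theta})|\,d\theta$, which is unaffected by monomial factors (including fractional powers of $t$). *)

(* Defs.v *)
From HB Require Import structures.
From mathcomp Require Import all_boot all_order all_algebra fingraph.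
From mathcomp Require Import all_classical all_reals all_analysis.
From mathcomp.real_closed Require Import complex.

Set Implicit Arguments.
Unset Strict Implicit.
Unset Printing Implicit Defensive.

Import Order.TTheory GRing.Theory Num.Theory.
Local Open Scope ring_scope.

(* Link diagrams as (oriented) planar-diagram codes.                         *)
(* A diagram with N crossings has 2N edges labelled 0, ..., 2N-1.            *)
(* A crossing X[a,b,c,d] lists the four edge-ends meeting at it in           *)
(* counterclockwise order, starting with the incoming end a of the           *)
(* under-strand (so the under-strand runs a -> c, the over-strand joins b    *)
(* and d).  [pd_over_db] is true iff the over-strand is oriented d -> b,     *)
(* which is exactly the case of a positive (right-handed) crossing.          *)
Record crossing := PDX { pd_a : nat; pd_b : nat; pd_c : nat; pd_d : nat;
                         pd_over_db : bool }.

Definition diagram := seq crossing.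

Definition crossing0 : crossing := PDX 0 0 0 0 true.

Definition crossing_sign (x : crossing) : int := if pd_over_db x then 1 else -1.
Definition writhe (D : diagram) : int := \sum_(x <- D) crossing_sign x.

Definition pair_rel (p q : nat) : rel nat :=
  fun e f => ((e == p) && (f == q)) || ((e == q) && (f == p)).

(* Smoothing of X[a,b,c,d]: the A-smoothing (s = true) joins the A-regions
   (those swept by rotating the over-strand counterclockwise), i.e. it
   connects the ends a-b and c-d; the B-smoothing (s = false) connects
   a-d and b-c. *)
Definition smoothing (x : crossing) (s : bool) : rel nat :=
  fun e f =>
    if s then pair_rel (pd_a x) (pd_b x) e f || pair_rel (pd_c x) (pd_d x) e f
    else pair_rel (pd_a x) (pd_d x) e f || pair_rel (pd_b x) (pd_c x) e f.

Definition kstate (D : diagram) := {ffun 'I_(size D) -> bool}.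

Definition edge (D : diagram) := 'I_(2 * size D).

Definition state_rel (D : diagram) (s : kstate D) : rel (edge D) :=
  fun e f => [exists i : 'I_(size D), smoothing (nth crossing0 D i) (s i) e f].

Definition nloops (D : diagram) (s : kstate D) : nat :=
  #|[set [set f | connect (state_rel s) e f] | e : edge D]|.

Definition nA (D : diagram) (s : kstate D) : nat := #|[set i | s i]|.
Definition nB (D : diagram) (s : kstate D) : nat := #|[set i | ~~ s i]|.

(* Kauffman bracket <D>, a Laurent polynomial in A, here evaluated at an
   arbitrary nonzero point A of a field F (taking F = fraction field of
   {poly int} and A = 'X gives the formal Laurent polynomial). *)
Definition kbracket (F : fieldType) (A : F) (D : diagram) : F :=
  \sum_(s : kstate D)
     A ^ ((nA s)%:Z - (nB s)%:Z) * (- A ^+ 2 - A ^- 2) ^+ (nloops s).-1.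

(* Jones polynomial V_D as a Laurent polynomial in A = t^(-1/4):
   V_D = (-A^3)^(-w(D)) <D>. *)
Definition jonesA (F : fieldType) (A : F) (D : diagram) : F :=
  (- A ^+ 3) ^ (- writhe D) * kbracket A D.

(* The pretzel link P(2k+1, ..., 2k+1) with n twist regions.                 *)
(* Region i (0 <= i < n) has m = 2k+1 crossings (i,j), j = 0..m-1 from top   *)
(* to bottom; the over-strand of every crossing is its NW-SE diagonal.       *)
(* Edges: T_i = i joins the top-right end of region i to the top-left end of *)
(* region i+1 (mod n); B_i = n + i likewise at the bottom; inside region i,  *)
(* between crossings j and j+1, the left edge L_(i,j) and right edge         *)
(* R_(i,j) = L_(i,j) + 1.  Orientation: in every region the strand through   *)
(* the top-left end runs downwards and the other strand runs upwards (this   *)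
(* is a consistent orientation since every region has an odd number of       *)
(* crossings; for n even it is one of the orientations of the 2-component    *)
(* link).  All crossings are then positive.                                  *)
Section Pretzel.
Variables (n k : nat).
Let m := k.*2.+1.
Let eT (i : nat) := i.
Let eB (i : nat) := (n + i)%N.
Let eL (i j : nat) := (2 * n + 2 * (i * (m - 1) + j))%N.
Let eR (i j : nat) := (eL i j).+1.
Let prev (i : nat) := ((i + n - 1) %% n)%N.

Definition pretzel_crossing (i j : nat) : crossing :=
  let NW := if j == 0%N then eT (prev i) else eL i j.-1 in
  let NE := if j == 0%N then eT i else eR i j.-1 in
  let SW := if j == m.-1 then eB (prev i) else eL i j in
  let SE := if j == m.-1 then eB i else eR i j in
  if ~~ odd j then PDX SW SE NE NW true  (* under SW -> NE, over NW -> SE *)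
  else PDX NE NW SW SE true.             (* under NE -> SW, over SE -> NW *)

Definition pretzel : diagram :=
  [seq pretzel_crossing i j | i <- iota 0 n, j <- iota 0 m].
End Pretzel.

(* Mahler measure of the Jones polynomial:                                  *)
(*   M(V) = exp \int_0^1 log |V(e^{2 pi i theta})| d theta,                 *)
(* where V(e^{2 pi i theta}) is V at A = e^{-i pi theta / 2}; the choice of  *)
(* the fourth root only changes V by a unimodular factor.                    *)
Definition jones_on_circle (R : realType) (D : diagram) (theta : R) : R[i] :=
  jonesA (Complex (cos (- (pi * theta / 2))) (sin (- (pi * theta / 2)))) D.

Definition mahler_jones (R : realType) (D : diagram) : \bar R :=
  expeR (\int[@lebesgue_measure R]_(theta in `[0%R, 1%R]%classic)
            (ln (Normc.normc (jones_on_circle D theta)))%:E)%E.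

(* Main.v *)
Require Import Defs.
From HB Require Import structures.
From mathcomp Require Import all_boot all_order all_algebra fingraph.
From mathcomp Require Import all_classical all_reals all_analysis.
From mathcomp Require Import measurable_realfun.
From mathcomp.real_closed Require Import complex.
From mathcomp Require Import ring lra zify.

(** Colouring the edges with [q] colours turns the Kauffman state sum at loop
    value [q] into a partition function, and the pretzel diagram into a cyclic
    chain of transfer matrices in the two-dimensional algebra spanned by the two
    smoothings; interpolating in [q] gives a closed formula for the bracket.
    With [s = A^4], [m = 2k+1] and [w = 1 + s^2 - s^3 + ... - s^m], it shows that
    on the unit circle [|V|] is [|v_n s|] for a polynomial [v_n] of degree at most
    [m n], with constant coefficient 1 up to sign, and with [(1 + s) v_n] congruent
    up to sign to [w^n] modulo [s^(n-1)].  Hence the low power sums of the inverse roots [b]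
    of [v_n], together with [-1], are [n] times those of [w].  As [w] has an
    inverse root of modulus greater than 1, testing against a polynomial that
    kills the other inverse roots of [w] gives a [D] with
    [n <= sum (max 1 |b|^D - 1)], so that [sum (ln (max 1 |b|))] tends to
    infinity.  Jensen's inequality bounds the logarithmic Mahler measure from
    below by this sum; it follows from Fatou's lemma applied to step functions
    sampled at points where the products over roots of unity are large. *)

Set Implicit Arguments.
Unset Strict Implicit.
Unset Printing Implicit Defensive.

Import Order.TTheory GRing.Theory Num.Theory.
Import numFieldNormedType.Exports.
Local Open Scope ring_scope.

(** * Colourings and transfer weights *)

(** Such a colouring is determined by its values at the canonical roots of the connected components,
    and these values are free. For a Kauffman state this turns [q ^ nloops] into a count of edge
    colourings. *)
Lemma card_locally_constant (T K : finType) (e : rel T) : symmetric e ->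
  #|[set c : {ffun T -> K} | [forall x, forall y, e x y ==> (c x == c y)]]| =
  (#|K| ^ #|[set [set y | connect e x y] | x : T]|)%N.
Proof.
move=> se; have sc := same_connect (sym_connect_sym se).
have rc x : connect e x (root e x) by apply: connect_root.
pose S := {x | roots e x}.
have rS x : roots e (root e x) by apply: roots_root; exact: sym_connect_sym.
pose f (g : {ffun S -> K}) : {ffun T -> K} :=
  [ffun x => g (Sub (root e x) (rS x))].
have -> : [set c : {ffun T -> K} | [forall x, forall y, e x y ==> (c x == c y)]]
          = f @: [set: {ffun S -> K}].
  apply/setP => c; rewrite inE; apply/idP/imsetP => [H|[g _ ->]].
    exists [ffun z : S => c (val z)] => //.
    apply/ffunP => x; rewrite !ffunE /=.
    case/connectP: (rc x) => p; elim: p x (root e x) => [|y p IH] x r /=.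
      by move=> _ ->.
    case/andP => exy py ->; rewrite -(IH _ _ py erefl).
    by move/forallP/(_ x)/forallP/(_ y): H; rewrite exy => /eqP.
  apply/forallP => x; apply/forallP => y; apply/implyP => exy.
  rewrite !ffunE; apply/eqP; congr (g _); apply: val_inj => /=.
  by apply/eqP; rewrite root_connect ?connect1 //; exact: sym_connect_sym.
rewrite card_imset; last first.
  move=> g h /ffunP E; apply/ffunP => -[z Hz].
  have := E z; rewrite !ffunE; congr (g _ = h _); apply: val_inj => /=;
  exact/eqP.
rewrite cardsT card_ffun card_sig; congr (_ ^ _)%N.
have -> : [set [set y | connect e x y] | x : T] =
          [set [set y | connect e x y] | x in [set z | roots e z]].
  apply/setP => A; apply/imsetP/imsetP => [[x _ ->]|[x _ ->]]; last by exists x.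
  exists (root e x); first by rewrite inE.
  by apply/setP => y; rewrite !inE (sc _ _ (rc x)).
rewrite card_in_imset ?cardsE // => x y; rewrite !inE => /eqP rx /eqP ry /setP E.
rewrite -rx -ry; apply/eqP; rewrite root_connect; last exact: sym_connect_sym.
by have := E y; rewrite !inE connect0.
Qed.

Section ColoringSums.
Variables (F : comNzRingType) (K : finType) (k0 : K).

(** Crossings name edges by plain naturals; the default colour [k0] lets them be coloured without
    bound proofs. *)
Definition extend N (c : {ffun 'I_N -> K}) (e : nat) : K :=
  if insub e is Some i then c i else k0.

Definition coloring_sum N (f : (nat -> K) -> F) : F :=
  \sum_(c : {ffun 'I_N -> K}) f (extend c).

Definition recolor (c : nat -> K) (e : nat) (x : K) : nat -> K :=
  fun e' => if e' == e then x else c e'.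

Lemma extend_ord N (c : {ffun 'I_N -> K}) (i : 'I_N) : extend c i = c i.
Proof. by rewrite /extend valK. Qed.

Lemma coloring_sum0 f : coloring_sum 0 f = f (fun=> k0).
Proof.
rewrite /coloring_sum (bigD1 [ffun=> k0]) //= big1 ?addr0; last first.
  by move=> c /eqP[]; apply/ffunP => -[].
by congr f; apply/funext => e; rewrite /extend; case: insubP => // -[].
Qed.

Lemma coloring_sumS N f :
  coloring_sum N.+1 f = \sum_(x : K) coloring_sum N (fun c => f (recolor c N x)).
Proof.
pose h (p : K * {ffun 'I_N -> K}) : {ffun 'I_N.+1 -> K} :=
  [ffun i => if unlift ord_max i is Some j then p.2 j else p.1].
pose g (c : {ffun 'I_N.+1 -> K}) : K * {ffun 'I_N -> K} :=
  (c ord_max, [ffun j => c (lift ord_max j)]).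
rewrite /coloring_sum pair_bigA /= (reindex h) /=; last first.
  exists g => [[x c] _|c _].
    rewrite /g /h ffunE unlift_none /=; congr (_, _).
    by apply/ffunP => j; rewrite !ffunE liftK.
  by apply/ffunP => i; rewrite !ffunE; case: unliftP => [j ->|->]; rewrite ?ffunE.
apply: eq_bigr => -[x c] _; congr f; apply/funext => e.
rewrite /recolor /extend; case: insubP => [i ltN <-|]; last first.
  rewrite -leqNgt => leN; case: insubP => [i ? _|_]; first by lia.
  by case: eqP => // eN; lia.
rewrite ffunE; case: unliftP => [j ->|->] /=; last by rewrite eqxx.
rewrite /bump leqNgt ltn_ord add0n; case: eqP => [E|_].
  by have := ltn_ord j; rewrite /= E ltnn.
by rewrite valK.
Qed.

Lemma eq_coloring_sum N f g : f =1 g -> coloring_sum N f = coloring_sum N g.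
Proof. by move=> fg; apply: eq_bigr. Qed.

End ColoringSums.

Definition compatible (K : eqType) (x : crossing) (t : bool) (c : nat -> K) : bool :=
  if t then (c (pd_a x) == c (pd_b x)) && (c (pd_c x) == c (pd_d x))
  else (c (pd_a x) == c (pd_d x)) && (c (pd_b x) == c (pd_c x)).

Definition crossing_bounded (N : nat) (x : crossing) : bool :=
  [&& (pd_a x < N)%N, (pd_b x < N)%N, (pd_c x < N)%N & (pd_d x < N)%N].

(** Once [#|K| ^ nloops s] is a sum over colourings, the two sums can be exchanged; for a fixed
    colouring the sum over states then factors crossing by crossing. *)
Lemma state_sum_colorings (F : comNzRingType) (K : finType) (k0 : K) (a b : F)
    (D : diagram) : all (crossing_bounded (2 * size D)) D ->
  \sum_(s : kstate D) a ^+ nA s * b ^+ nB s * (#|K| ^ nloops s)%:R =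
  coloring_sum k0 (2 * size D) (fun c =>
    \prod_(x <- D) (a * (compatible x true c)%:R + b * (compatible x false c)%:R)).
Proof.
move=> /(all_nthP crossing0) bD.
have wE (s : kstate D) :
    a ^+ nA s * b ^+ nB s = \prod_(i < size D) (if s i then a else b).
  rewrite (bigID (fun i => s i)) /= /nA /nB.
  rewrite (eq_bigr (fun=> a)); last by move=> i ->.
  rewrite [X in _ = _ * X](eq_bigr (fun=> b)); last by move=> i /negbTE ->.
  by rewrite !prodr_const !cardsE.
have cE (s : kstate D) : ((#|K| ^ nloops s)%:R : F) =
    \sum_(c : {ffun edge D -> K})
      \prod_(i < size D) (compatible (nth crossing0 D i) (s i) (extend k0 c))%:R.
  rewrite /nloops -card_locally_constant; last first.
    move=> e f; rewrite /state_rel; apply: eq_existsb => i.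
    by rewrite /smoothing /pair_rel; case: (s i); lia.
  rewrite -sum1_card natr_sum big_mkcond /=; apply: eq_bigr => c _.
  rewrite -natr_prod inE.
  (* Being constant along the state is a condition at each crossing separately; [bD] makes the four
     labels genuine edges. *)
  have -> : [forall x, forall y, state_rel s x y ==> (c x == c y)] =
      [forall i : 'I_(size D), compatible (nth crossing0 D i) (s i) (extend k0 c)].
    apply/forallP/forallP => [H i|H e].
      case/and4P: (bD i (ltn_ord i)); set x := nth _ _ _ => ha hb hc hd.
      have L (e f : edge D) : smoothing x (s i) e f ->
          extend k0 c e == extend k0 c f.
        move=> sef; rewrite !extend_ord.
        move/forallP/(_ f): (H e); rewrite /state_rel => /implyP; apply.
        by apply/existsP; exists i.
      have L1 := L (Ordinal ha) (Ordinal hb).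
      have L2 := L (Ordinal hc) (Ordinal hd).
      have L3 := L (Ordinal ha) (Ordinal hd).
      have L4 := L (Ordinal hb) (Ordinal hc).
      move: L1 L2 L3 L4; rewrite /smoothing /pair_rel /compatible /=.
      by case: (s i); rewrite !eqxx ?orbT /= => l1 l2 l3 l4; apply/andP; split; auto.
    apply/forallP => f; apply/implyP => /existsP [j +].
    have := H j; rewrite -(extend_ord k0 c e) -(extend_ord k0 c f).
    rewrite /smoothing /pair_rel /compatible; case: (s j) => /andP[/eqP h1 /eqP h2];
    by move/orP => [] /orP[] /andP[/eqP -> /eqP ->]; rewrite ?h1 ?h2.
  case: forallP => [H|/forallP]; first by rewrite big1 // => i _; rewrite H.
  rewrite negb_forall => /existsP[j /negbTE h].
  by rewrite (bigD1 j) //= h mul0n.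
under eq_bigr => s _ do rewrite wE cE mulr_sumr.
rewrite exchange_big /=; apply: eq_bigr => c _.
rewrite (big_nth crossing0) big_mkord.
pose G (i : 'I_(size D)) (t : bool) : F :=
  (if t then a else b) * (compatible (nth crossing0 D i) t (extend k0 c))%:R.
transitivity (\sum_(s : kstate D) \prod_(i < size D) G i (s i)).
  by apply: eq_bigr => s _; rewrite -big_split.
rewrite -bigA_distr_bigA /=; apply: eq_bigr => i _.
by rewrite big_bool.
Qed.

(** * Stacking two-strand tangles and closing up chains of them *)

Section TransferWeights.
Variable F : comNzRingType.

(* The two-strand tangle [a E + b I] as a function of the colours of its four
   ends, where [E] joins the ends horizontally and [I] vertically. *)
Definition tangle_weight (K : eqType) (a b : F) (nw ne sw se : K) : F :=
  a * ((nw == ne) && (sw == se))%:R + b * ((nw == sw) && (ne == se))%:R.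

(* [(a E + b I)^t = hook_coef t E + b^t I] in the Temperley-Lieb algebra with
   loop value [q]. *)
Fixpoint hook_coef (F' : comNzRingType) (a b q : F') (t : nat) : F' :=
  if t is t'.+1 then (a * q + b) * hook_coef a b q t' + a * b ^+ t' else 0.

Lemma tangle_weight_rotate (K : eqType) (a b : F) (nw ne sw se : K) :
  tangle_weight a b nw ne sw se = tangle_weight b a nw sw ne se.
Proof. by rewrite /tangle_weight addrC. Qed.

Lemma sum_delta (K : finType) (l : K) (f : K -> F) :
  \sum_x (l == x)%:R * f x = f l.
Proof.
rewrite (bigD1 l) //= eqxx mul1r big1 ?addr0 // => x /negbTE.
by rewrite eq_sym => ->; rewrite mul0r.
Qed.

(** Summing over the two middle colours is the product of the Temperley-Lieb algebra: [I] is the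
    identity and [E E = q E], the factor [q] being the free colour of a closed loop. *)
Lemma tangle_weight_comp (K : finType) (a b : F) (t : nat) (l r l' r' : K) :
  let q := #|K|%:R in
  \sum_x \sum_y tangle_weight a b l r x y *
    tangle_weight (hook_coef a b q t) (b ^+ t) x y l' r' =
  tangle_weight (hook_coef a b q t.+1) (b ^+ t.+1) l r l' r'.
Proof.
move=> q; set h := hook_coef a b q t; set w := tangle_weight h _.
have -> : \sum_x \sum_y tangle_weight a b l r x y * w x y l' r' =
    \sum_x \sum_y (x == y)%:R * (a * (l == r)%:R * w x y l' r') +
    \sum_x (l == x)%:R * (\sum_y (r == y)%:R * (b * w x y l' r')).
  rewrite -big_split; apply: eq_bigr => x _ /=; rewrite mulr_sumr -big_split.
  apply: eq_bigr => y _ /=; rewrite {1}/tangle_weight -!mulnb !natrM; ring.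
rewrite sum_delta sum_delta.
have -> : \sum_x \sum_y (x == y)%:R * (a * (l == r)%:R * w x y l' r') =
    \sum_(x : K) (a * (l == r)%:R * h * (l' == r')%:R) +
    \sum_x (l' == x)%:R * (a * (l == r)%:R * b ^+ t * (x == r')%:R).
  rewrite -big_split; apply: eq_bigr => x _ /=; rewrite sum_delta /w /tangle_weight.
  rewrite eqxx -!mulnb !natrM (eq_sym l' x); ring.
rewrite sum_delta sumr_const -[_ *+ #|_|]mulr_natl -/q /w /tangle_weight /= exprS -/h.
rewrite -!mulnb !natrM; ring.
Qed.

(** The last two edges will be the inner edges between consecutive crossings. The hypotheses say
    that [f] ignores them and that [g] sees them only through its two explicit arguments, so they
    can be summed out. *)
Lemma coloring_sum_peel2 (K : finType) (k0 : K) N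
    (f : (nat -> K) -> F) (g : (nat -> K) -> K -> K -> F) :
  (forall c c', (forall e, (e < N)%N -> c e = c' e) -> f c = f c') ->
  (forall c c', (forall e, (e < N)%N -> c e = c' e) -> g c = g c') ->
  coloring_sum k0 N.+2 (fun c => f c * g c (c N) (c N.+1)) =
  coloring_sum k0 N (fun c => f c * \sum_x \sum_y g c x y).
Proof.
move=> fN gN; rewrite coloring_sumS.
under eq_bigr => x _ do rewrite coloring_sumS.
rewrite exchange_big /= /coloring_sum.
under eq_bigr => x _ do rewrite exchange_big.
rewrite exchange_big /=; apply: eq_bigr => c _.
rewrite mulr_sumr; apply: eq_bigr => x _; rewrite mulr_sumr; apply: eq_bigr => y _.
have E e : (e < N)%N ->
    recolor (recolor (extend k0 c) N x) N.+1 y e = extend k0 c e.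
  by move=> lt; rewrite /recolor; do 2 (case: eqP => [?|_]; first by lia).
rewrite (fN _ _ E) (gN _ _ E) {1}/recolor (ltn_eqF (ltnSn N)) /recolor.
by rewrite !eqxx.
Qed.

(** Edges [e] and [N + e] are merged into one site with a pair of colours, as needed for [T_i] and
    [B_i], which together separate neighbouring twist regions. *)
Lemma coloring_sum_pairs (K : finType) (k0 : K) N (f : (nat -> K) -> F) :
  coloring_sum k0 (N + N) f =
  coloring_sum (k0, k0) N
    (fun p => f (fun e => if (e < N)%N then (p e).1 else (p (e - N)%N).2)).
Proof.
pose h (p : {ffun 'I_N -> K * K}) : {ffun 'I_(N + N) -> K} :=
  [ffun i => match fintype.split i with inl j => (p j).1 | inr j => (p j).2 end].
pose g (c : {ffun 'I_(N + N) -> K}) : {ffun 'I_N -> K * K} :=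
  [ffun i => (c (lshift N i), c (rshift N i))].
rewrite /coloring_sum (reindex h) /=; last first.
  exists g => [p _|c _]; apply/ffunP => i; rewrite !ffunE.
    rewrite -[lshift _ _]/(unsplit (inl i)) -[rshift _ _]/(unsplit (inr i)).
    by rewrite !unsplitK; case: (p i).
  by case: fintype.splitP => j E; rewrite !ffunE /=; congr (c _); apply: val_inj.
apply: eq_bigr => p _; congr f; apply/funext => e; rewrite /extend.
case: insubP => [i lt /= <-|]; last first.
  rewrite -leqNgt => le; case: ltnP => [|le']; first by lia.
  by rewrite insubN // -leqNgt; lia.
rewrite ffunE; case: fintype.splitP => j -> /=; first by rewrite valK.
by rewrite addKn valK.
Qed.

(** A cyclic chain of transfer matrices computes the trace of a power of [a E + b I] on pairs of
    colours, where [E] has trace [q] and [I] has trace [q ^+ 2]. *)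
Lemma ring_sum (K : finType) (k0 : K) (a b : F) (n : nat) :
  let q := #|K|%:R in
  coloring_sum (k0, k0) n.+1 (fun p =>
    \prod_(i < n.+1) tangle_weight a b (p ((i + n.+1 - 1) %% n.+1)%N).1
      (p ((i + n.+1 - 1) %% n.+1)%N).2 (p i).1 (p i).2) =
  hook_coef a b q n.+1 * q + b ^+ n.+1 * q ^+ 2.
Proof.
move=> q.
pose w t (x y : K * K) := tangle_weight (hook_coef a b q t) (b ^+ t) x.1 x.2 y.1 y.2.
have w1 x y : w 1%N x y = tangle_weight a b x.1 x.2 y.1 y.2.
  by rewrite /w /= mulr0 add0r mulr1 expr1.
have wS t x y : \sum_z w 1%N x z * w t z y = w t.+1 x y.
  rewrite /w -[RHS]tangle_weight_comp -/q pair_bigA /=; apply: eq_bigr => z _.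
  by rewrite mulr0 add0r mulr1 expr1.
(* An open chain of [t] single weights is closed up by an [r]-fold one; summing out the last site
   raises [r] by one. *)
have path t r : coloring_sum (k0, k0) t.+1 (fun p =>
    (\prod_(i < t) w 1%N (p i) (p i.+1)) * w r (p t) (p 0%N)) =
    \sum_x w (r + t)%N x x.
  elim: t r => [|t IH] r.
    rewrite coloring_sumS addn0; apply: eq_bigr => x _.
    by rewrite coloring_sum0 big_ord0 mul1r /recolor eqxx.
  rewrite coloring_sumS -addSnnS -IH exchange_big /=; apply: eq_bigr => c _.
  under eq_bigr => x _.
    rewrite big_ord_recr /= /recolor eqxx (ltn_eqF (ltnSn _)) /= -mulrA.
    rewrite (eq_bigr (fun i : 'I_t => w 1%N (extend (k0,k0) c i) (extend (k0,k0) c i.+1))).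
      over.
    move=> i _; have := ltn_ord i.
    by do 2 (case: eqP => [?|_]; first by lia).
  by rewrite -mulr_sumr; congr (_ * _); exact: wS.
transitivity (\sum_x w (1 + n)%N x x).
  rewrite -path; apply: eq_coloring_sum => p.
  rewrite big_ord_recl /= mulrC; congr (_ * _).
    apply: eq_bigr => i _; rewrite w1 /bump /=.
    have -> : ((1 + i + n.+1 - 1) %% n.+1 = i)%N.
      rewrite (_ : _ - _ = i + n.+1)%N ?modnDr ?modn_small //; last by lia.
      by have := ltn_ord i; lia.
    by rewrite add1n.
  rewrite w1; have -> // : ((0 + n.+1 - 1) %% n.+1 = n)%N.
  by rewrite add0n subn1 modn_small.
rewrite add1n /w -(pair_bigA _ (fun x y => tangle_weight (hook_coef a b q n.+1)
  (b ^+ n.+1) x y x y)) /=.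
set h := _ + a * _; set bn := b ^+ _.
have -> : \sum_(x : K) \sum_y tangle_weight h bn x y x y =
    \sum_(x : K) \sum_y (x == y)%:R * h + \sum_(x : K) \sum_(y : K) bn.
  rewrite -big_split; apply: eq_bigr => x _ /=; rewrite -big_split.
  by apply: eq_bigr => y _; rewrite /tangle_weight !eqxx andbb mulr1 mulrC.
under eq_bigr => x _ do rewrite sum_delta.
rewrite !sumr_const -[h *+ _]mulr_natr -[bn *+ _ *+ _]mulr_natr -[bn *+ _]mulr_natr.
by rewrite -/q; ring.
Qed.

(** * Partition function of the pretzel diagram *)

Section PretzelSum.
Variables (K : finType) (k0 : K) (a b : F) (n k : nat).
Hypothesis n_gt0 : (0 < n)%N.
Let q : F := #|K|%:R.
Let m := k.*2.+1.
Let eL (i j : nat) := (2 * n + 2 * (i * (m - 1) + j))%N.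
Let prev (i : nat) := ((i + n - 1) %% n)%N.
Let top_left i j := if j == 0%N then prev i else eL i j.-1.
Let top_right i j := if j == 0%N then i else (eL i j.-1).+1.
Let bot_left i j := if j == m.-1 then (n + prev i)%N else eL i j.
Let bot_right i j := if j == m.-1 then (n + i)%N else (eL i j).+1.
Let w (i j : nat) (c : nat -> K) := tangle_weight a b
  (c (top_left i j)) (c (top_right i j)) (c (bot_left i j)) (c (bot_right i j)).
(** The weight of [r] stacked crossings, interior summed out, hung between level [t] and the bottom
    of region [i]. *)
Let w' (r t i : nat) (c : nat -> K) := tangle_weight (hook_coef a b q r) (b ^+ r)
  (c (top_left i t)) (c (top_right i t)) (c (n + prev i)%N) (c (n + i)%N).

Let prev_lt i : (prev i < n)%N. Proof. by rewrite ltn_mod. Qed.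

(** The two parities of [j] list the corners with a half turn between them, which preserves both
    smoothings: the A-smoothing is always the horizontal [E]. *)
Lemma pretzel_crossing_weight i j (c : nat -> K) :
  a * (compatible (pretzel_crossing n k i j) true c)%:R +
  b * (compatible (pretzel_crossing n k i j) false c)%:R = w i j c.
Proof.
rewrite /w /tangle_weight /pretzel_crossing -/m -/(eL _ _) -/(prev _).
rewrite -/(top_left i j) -/(top_right i j) -/(bot_left i j) -/(bot_right i j).
rewrite /compatible; case: (odd j) => /=.
  congr (a * _%:R + b * _%:R); last by rewrite andbC.
  by rewrite (eq_sym (c (top_right i j))).
congr (a * _%:R + b * _%:R).
  by rewrite andbC (eq_sym (c (top_right i j))).
by rewrite (eq_sym (c (bot_left i j))) (eq_sym (c (bot_right i j))).
Qed.

(** The region is collapsed from the bottom up: [eL i t] counts the edges numbered before level [t]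
    of region [i], so the two edges just above the current stack are always the last ones, and
    summing them out absorbs one more crossing. *)
Lemma twist_region_sum i t r (f : (nat -> K) -> F) : (i < n)%N -> (t < m)%N ->
  (forall c c', (forall e, (e < eL i 0)%N -> c e = c' e) -> f c = f c') ->
  coloring_sum k0 (eL i t) (fun c => f c * (\prod_(j < t) w i j c) * w' r t i c) =
  coloring_sum k0 (eL i 0) (fun c => f c * w' (r + t)%N 0 i c).
Proof.
move=> lt_in; have pl := prev_lt i.
elim: t r => [|t IH] r lt_tm fN.
  by rewrite addn0; apply: eq_coloring_sum => c; rewrite big_ord0 mulr1.
rewrite -addSnnS -IH ?(ltnW lt_tm) //.
pose g (c : nat -> K) (x y : K) : F :=
  tangle_weight a b (c (top_left i t)) (c (top_right i t)) x y *
  tangle_weight (hook_coef a b q r) (b ^+ r) x y (c (n + prev i)%N) (c (n + i)%N).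
have eLS : eL i t.+1 = (eL i t).+2 by rewrite /eL; lia.
have gE c : \sum_x \sum_y g c x y = w' r.+1 t i c.
  by rewrite /g tangle_weight_comp.
under [RHS]eq_coloring_sum => c do rewrite -gE.
rewrite -coloring_sum_peel2; first last.
- move=> c c' E; apply/funext => x; apply/funext => y; rewrite /g.
  by rewrite !E //; rewrite /top_left /top_right /eL; try case: eqP; nia.
- move=> c c' E; congr (_ * _).
    by apply: fN => e lt; apply: E; move: lt; rewrite /eL; lia.
  apply: eq_bigr => j _; have ltj := ltn_ord j.
  have -> : w i j c = tangle_weight a b (c (top_left i j)) (c (top_right i j))
      (c (eL i j)) (c (eL i j).+1).
    by rewrite /w /bot_left /bot_right !ifN //; lia.
  have -> : w i j c' = tangle_weight a b (c' (top_left i j)) (c' (top_right i j))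
      (c' (eL i j)) (c' (eL i j).+1).
    by rewrite /w /bot_left /bot_right !ifN //; lia.
  by congr (tangle_weight _ _ _ _ _ _); apply: E;
    rewrite /top_left /top_right /eL; try case: eqP; nia.
rewrite -eLS; apply: eq_coloring_sum => c.
rewrite big_ord_recr /= mulrA -mulrA; congr (_ * _).
rewrite /g; congr (_ * _).
by rewrite /w /bot_left /bot_right !ifN //; lia.
Qed.

(** Regions are collapsed from the last to the first, since inner edges are numbered region by
    region. The collapsed weight involves only the [2 * n] outer edges and can therefore join [f] in
    the induction. *)
Lemma twist_regions_sum I (f : (nat -> K) -> F) : (I <= n)%N ->
  (forall c c', (forall e, (e < 2 * n)%N -> c e = c' e) -> f c = f c') ->
  coloring_sum k0 (eL I 0) (fun c => f c * \prod_(i < I) \prod_(j < m) w i j c) =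
  coloring_sum k0 (2 * n) (fun c => f c * \prod_(i < I) w' m 0 i c).
Proof.
elim: I f => [|I IH] f le_In fN.
  by rewrite /eL mul0n !addn0; apply: eq_coloring_sum => c; rewrite !big_ord0.
have -> : eL I.+1 0 = eL I (m - 1) by rewrite /eL; lia.
have pI := prev_lt I.
transitivity (coloring_sum k0 (eL I 0) (fun c =>
   (f c * w' m 0 I c) * \prod_(i < I) \prod_(j < m) w i j c)); last first.
  rewrite IH ?(ltnW le_In) // => [|c c' E].
    by apply: eq_coloring_sum => c; rewrite big_ord_recr /= -mulrA; congr (_ * _); rewrite mulrC.
  rewrite (fN _ _ E); congr (_ * _).
  by congr (tangle_weight _ _ _ _ _ _); apply: E; rewrite /top_left /top_right /=; lia.
(* The lowest crossing ends on the outer bottom edges, so it serves as the initial stack, of height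
   1. *)
transitivity (coloring_sum k0 (eL I (m - 1)) (fun c =>
   (f c * \prod_(i < I) \prod_(j < m) w i j c) * (\prod_(j < m - 1) w I j c) *
   w' 1 (m - 1) I c)).
  apply: eq_coloring_sum => c; rewrite big_ord_recr /= -!mulrA; congr (_ * (_ * _)).
  have -> : \prod_(j < m) w I j c = \prod_(j < (m - 1).+1) w I j c by rewrite subn1.
  rewrite big_ord_recr /=; congr (_ * _).
  rewrite /w /w' /= mulr0 add0r mulr1 expr1 /bot_left /bot_right.
  by rewrite subn1 eqxx.
rewrite twist_region_sum //.
- rewrite subnKC // ; apply: eq_coloring_sum => c; ring.
- by rewrite subn1.
move=> c c' E; rewrite (fN c c'); last by move=> e lt; apply: E; rewrite /eL; lia.
congr (_ * _); apply: eq_bigr => i _; apply: eq_bigr => j _.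
have lti := ltn_ord i; have ltj := ltn_ord j; have pi := prev_lt i.
by congr (tangle_weight _ _ _ _ _ _); apply: E;
  rewrite /top_left /top_right /bot_left /bot_right /eL; case: eqP; nia.
Qed.

Lemma size_pretzel : size (pretzel n k) = (n * m)%N.
Proof. by rewrite size_allpairs !size_iota. Qed.

Lemma pretzel_bounded : all (crossing_bounded (2 * size (pretzel n k))) (pretzel n k).
Proof.
rewrite size_pretzel /pretzel -/m.
suff bounded i j : (i < n)%N -> (j < m)%N ->
    crossing_bounded (2 * (n * m)) (pretzel_crossing n k i j).
  have lt_n i : i \in iota 0 n -> (i < n)%N by rewrite mem_iota.
  have lt_m j : j \in iota 0 m -> (j < m)%N by rewrite mem_iota.
  move: (iota 0 m) lt_m => t lt_m.
  elim: (iota 0 n) lt_n => [|i s IH] //= lt_n; rewrite all_cat IH ?andbT; last first.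
    by move=> i' si; apply: lt_n; rewrite inE si orbT.
  rewrite all_map; apply/allP => j /lt_m ltj.
  by apply: bounded => //; apply: lt_n; rewrite inE eqxx.
move=> lti ltj.
have pl := prev_lt i.
have b1 : (top_left i j < 2 * (n * m))%N by rewrite /top_left /eL; case: eqP; nia.
have b2 : (top_right i j < 2 * (n * m))%N by rewrite /top_right /eL; case: eqP; nia.
have b3 : (bot_left i j < 2 * (n * m))%N by rewrite /bot_left /eL; case: eqP; nia.
have b4 : (bot_right i j < 2 * (n * m))%N by rewrite /bot_right /eL; case: eqP; nia.
rewrite /pretzel_crossing -/m -/(eL _ _) -/(prev _).
rewrite -/(top_left i j) -/(top_right i j) -/(bot_left i j) -/(bot_right i j).
by rewrite /crossing_bounded; case: (odd j) => /=; rewrite b1 b2 b3 b4.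
Qed.

Lemma pretzel_state_sum :
  \sum_(s : kstate (pretzel n k)) a ^+ nA s * b ^+ nB s * (#|K| ^ nloops s)%:R =
  hook_coef (b ^+ m) (hook_coef a b q m) q n * q + hook_coef a b q m ^+ n * q ^+ 2.
Proof.
rewrite (state_sum_colorings k0 _ _ pretzel_bounded) size_pretzel.
transitivity (coloring_sum k0 (eL n 0)
    (fun c => 1 * \prod_(i < n) \prod_(j < m) w i j c)).
  have -> : eL n 0 = (2 * (n * m))%N by rewrite /eL; nia.
  apply: eq_coloring_sum => c; rewrite /pretzel big_allpairs_dep mul1r.
  rewrite -(big_mkord xpredT (fun i => \prod_(j < m) w i j c)) /index_iota subn0.
  apply: eq_bigr => i _.
  rewrite -(big_mkord xpredT (fun j => w i j c)) /index_iota subn0 -/m.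
  by apply: eq_bigr => j _; exact: pretzel_crossing_weight.
(* Only the edges [T_i] and [B_i] remain. Chaining the regions sideways reads each of them after a
   quarter turn, which exchanges the coefficients of [E] and [I]. *)
rewrite twist_regions_sum // mul2n -addnn coloring_sum_pairs.
have := ring_sum k0 (b ^+ m) (hook_coef a b q m) n.-1; rewrite prednK // => <-.
apply: eq_coloring_sum => p; rewrite mul1r; apply: eq_bigr => i _.
rewrite /w' /= tangle_weight_rotate prev_lt ltn_ord.
rewrite !ltnNge !leq_addr /= !addKn.
by [].
Qed.

End PretzelSum.
End TransferWeights.

(** * The polynomial of the pretzel bracket *)

(** The positive integers are infinitely many points in characteristic 0. The loop value has so far
    been a number of colours; this frees it. *)
Lemma poly_eq_on_nat (F : numDomainType) (p r : {poly F}) :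
  (forall q : nat, p.[q.+1%:R] = r.[q.+1%:R]) -> p = r.
Proof.
move=> E; apply/eqP; rewrite -subr_eq0; apply/negPn/negP => nz.
have := @max_poly_roots _ (p - r) [seq i.+1%:R | i <- iota 0 (size (p - r))] nz.
rewrite size_map size_iota ltnn => H; suff : false by []; apply: H.
  by apply/allP => _ /mapP[i _ ->]; rewrite rootE !hornerE E subrr.
by rewrite map_inj_uniq ?iota_uniq // => i j /eqP; rewrite eqr_nat => /eqP[].
Qed.

Lemma horner_hook_coef (F : comNzRingType) (a b q : {poly F}) (x : F) t :
  (hook_coef a b q t).[x] = hook_coef a.[x] b.[x] q.[x] t.
Proof. by elim: t => [|t IH] /=; rewrite !hornerE // IH. Qed.

Lemma nloops_gt0 (D : diagram) (s : kstate D) : (0 < size D)%N -> (0 < nloops s)%N.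
Proof.
move=> D0; have e0 : (0 < 2 * size D)%N by rewrite muln_gt0.
apply/card_gt0P; exists [set f | connect (state_rel s) (Ordinal e0) f].
exact: imset_f.
Qed.

(** Both sides are polynomials in the loop value that agree at every positive integer by
    [pretzel_state_sum]; they are then evaluated at [d]. *)
Lemma kbracket_pretzel (F : numFieldType) (A : F) (n k : nat) :
  A != 0 -> (0 < n)%N ->
  let m := k.*2.+1 in
  let d := - A ^+ 2 - A ^- 2 in
  let c := hook_coef A A^-1 d m in
  kbracket A (pretzel n k) = hook_coef (A^-1 ^+ m) c d n + c ^+ n * d.
Proof.
move=> A0 n0 m d c.
pose D := pretzel n k.
have D0 : (0 < size D)%N by rewrite size_pretzel muln_gt0 n0.
pose P : {poly F} :=
  \sum_(s : kstate D) (A ^+ nA s * A^-1 ^+ nB s) *: 'X^((nloops s).-1).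
pose C : {poly F} := hook_coef A%:P (A^-1)%:P 'X m.
pose Q : {poly F} := hook_coef (A^-1 ^+ m)%:P C 'X n + C ^+ n * 'X.
have QE x : Q.[x] = hook_coef (A^-1 ^+ m) (hook_coef A A^-1 x m) x n +
                    hook_coef A A^-1 x m ^+ n * x.
  have CE : C.[x] = hook_coef A A^-1 x m by rewrite horner_hook_coef !hornerC hornerX.
  by rewrite /Q hornerD hornerM horner_exp horner_hook_coef CE !hornerC hornerX.
have PQ : P = Q.
  apply: poly_eq_on_nat => q.
  have q0 : (q.+1%:R : F) != 0 by rewrite pnatr_eq0.
  (* The bracket has exponent [(nloops s).-1], one less than the count of colourings. *)
  apply: (mulIf q0).
  have := @pretzel_state_sum F 'I_q.+1 ord0 A A^-1 n k n0.
  rewrite card_ord -/m -/D => E.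
  transitivity (\sum_(s : kstate D) A ^+ nA s * A^-1 ^+ nB s * (q.+1 ^ nloops s)%:R).
    rewrite /P horner_sum mulr_suml; apply: eq_bigr => s _.
    by rewrite hornerZ hornerXn natrX -(prednK (nloops_gt0 s D0)) exprSr /= !mulrA.
  by rewrite E QE mulrDl expr2 mulrA.
transitivity P.[d].
  rewrite /P horner_sum /kbracket -/D; apply: eq_bigr => s _.
  rewrite hornerZ hornerXn; congr (_ * _).
  by rewrite expfzDr // -exprnN exprVn.
by rewrite PQ QE.
Qed.

Lemma hook_coefM (F : comNzRingType) (l a b q : F) t :
  hook_coef (l * a) (l * b) q t = l ^+ t * hook_coef a b q t.
Proof.
elim: t => [|t IH] /=; first by rewrite mulr0.
by rewrite IH exprMn exprS; ring.
Qed.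

Lemma hook_coefMl (F : comNzRingType) (a b q : F) t :
  hook_coef a b q t = a * hook_coef 1 b (a * q) t.
Proof.
elim: t => [|t IH] /=; first by rewrite mulr0.
by rewrite IH mul1r; ring.
Qed.

Section JonesPoly.
Variables (F : numFieldType) (k : nat).
Let m := k.*2.+1.

(** This is [(1 + X^m) / (1 + X)], up to a monomial the coefficient of [E] in a twist region. *)
Definition alt_poly : {poly F} := \sum_(j < m) (- 'X) ^+ j.

(** The polynomial [w] of the overview. Its opposite is the factor [a q + b] in the recursion of the
    [hook_coef] of [jones_poly]. *)
Definition jones_base : {poly F} := 1 + 'X - 'X * alt_poly.

(* With [s = A^4], the bracket of the pretzel diagram is a monomial in [A]
   times the value at [s] of this polynomial. *)
Definition jones_poly (n : nat) : {poly F} :=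
  hook_coef 1 ('X * alt_poly) (- (1 + 'X)) n - (1 + 'X) * alt_poly ^+ n * 'X^(n.-1).

Lemma alt_polyE : alt_poly = hook_coef 1 1 (- 'X - 1) m.
Proof.
rewrite /alt_poly; elim: m => [|t IH] /=; first by rewrite big_ord0.
rewrite -IH big_ord_recl expr0 expr1n mulr_sumr mulr1 [LHS]addrC; congr (_ + _).
by apply: eq_bigr => i _; rewrite /bump /= exprS; ring.
Qed.

Lemma alt_poly_mul : (1 + 'X) * alt_poly = 1 + 'X^m.
Proof.
have -> : 1 + 'X^m = 1 - (- 'X) ^+ m :> {poly F}.
  by rewrite exprNn -signr_odd /= odd_double /= expr1; ring.
by rewrite -[1 in RHS](expr1n _ m) subrXX opprK; congr (_ * _);
  apply: eq_bigr => i _; rewrite expr1n mul1r.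
Qed.

(** Since [A ^+ 2 * d = - (1 + s)], the homogeneity of [hook_coef] extracts the powers of [A]; the
    scale common to both coefficients is [A^-1 ^+ m * A ^- 2]. *)
Lemma kbracket_jones_poly (A : F) n : A != 0 -> (0 < n)%N ->
  kbracket A (pretzel n k) =
  (A^-1 ^+ m * A ^- 2) ^+ n * A ^+ 2 * (jones_poly n).[A ^+ 4].
Proof.
move=> A0 n0; rewrite kbracket_pretzel // -/m; set d := - _ - _.
set s := A ^+ 4; have Ad : A ^+ 2 * d = - (1 + s) by rewrite /d /s; field.
have cE : hook_coef A A^-1 d m = A^-1 ^+ m * A ^- 2 * (s * alt_poly.[s]).
  have -> : hook_coef A A^-1 d m = hook_coef (A^-1 * A ^+ 2) (A^-1 * 1) d m.
    by congr hook_coef; field.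
  rewrite hook_coefM hook_coefMl Ad alt_polyE horner_hook_coef.
  rewrite !(hornerD, hornerN, hornerX, hornerC) opprD [- 1 - s]addrC.
  rewrite -mulrA; congr (_ * _); rewrite mulrA; congr (_ * _).
  by rewrite /s; field.
set l := A^-1 ^+ m * A ^- 2 in cE *.
have -> : A^-1 ^+ m = l * A ^+ 2 by rewrite /l mulfVK // expf_neq0.
rewrite cE hook_coefM hook_coefMl Ad [(l * _) ^+ n]exprMn.
have ds : s * d = - (1 + s) * A ^+ 2 by rewrite /d /s; field.
have -> : (jones_poly n).[s] =
    hook_coef 1 (s * alt_poly.[s]) (- (1 + s)) n - (1 + s) * alt_poly.[s] ^+ n * s ^+ n.-1.
  rewrite /jones_poly !(hornerD, hornerN, hornerM) horner_exp hornerXn horner_hook_coef.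
  by rewrite !(hornerD, hornerN, hornerM, hornerX, hornerC).
have -> : (s * alt_poly.[s]) ^+ n = s * (s ^+ n.-1 * alt_poly.[s] ^+ n).
  by rewrite exprMn mulrA -exprS prednK.
set H := hook_coef _ _ _ _; set t := s ^+ n.-1 * _.
rewrite (_ : l ^+ n * (s * t) * d = l ^+ n * t * (s * d)); last by ring.
by rewrite ds /t; ring.
Qed.

(** The recursion for [hook_coef] is a geometric sum: [a q] times it equals [(a q + b)^n - b^n].
    Here [b^n] is divisible by [X^n], so only the power of [jones_base] survives modulo
    [X^(n-1)]. *)
Lemma jones_poly_mul n : (0 < n)%N -> - (1 + 'X) * jones_poly n =
  (- jones_base) ^+ n + 'X^(n.-1) * alt_poly ^+ n * (1 + 'X + 'X^2).
Proof.
move=> n0; rewrite /jones_poly.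
have hE t : - (1 + 'X) * hook_coef 1 ('X * alt_poly) (- (1 + 'X)) t =
    (- jones_base) ^+ t - ('X * alt_poly) ^+ t.
  elim: t => [|t IH] /=; first by rewrite mulr0 !expr0 subrr.
  rewrite mul1r mulrDr mulrCA IH mul1r !exprS /jones_base; ring.
rewrite mulrBr hE exprMn.
have -> : 'X^n = 'X * 'X^(n.-1) :> {poly F} by rewrite -exprS prednK.
by ring.
Qed.

Lemma jones_base_mul : (1 + 'X) * jones_base = 1 + 'X + 'X^2 - 'X^(m.+1).
Proof.
rewrite /jones_base mulrBr mulrCA alt_poly_mul [in RHS](exprS _ m); ring.
Qed.

Lemma size_alt_poly : (size alt_poly <= m)%N.
Proof.
apply: (leq_trans (size_sum _ _ _)); apply/bigmax_leqP => i _.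
by rewrite exprNn -signr_odd mulr_sign; case: ifP; rewrite ?size_polyN size_polyXn.
Qed.

Lemma size_onePX : size (1 + 'X : {poly F})%R = 2%N.
Proof. by rewrite addrC -[1]/(1%:P) size_XaddC. Qed.

Lemma size_Xalt_poly : (size ('X * alt_poly)%R <= m.+1)%N.
Proof.
rewrite mulrC; have [->|nz] := eqVneq alt_poly 0; first by rewrite mul0r size_poly0.
by rewrite size_mulX // ltnS size_alt_poly.
Qed.

Lemma size_jones_base : (size jones_base <= m.+1)%N.
Proof.
apply: (leq_trans (size_polyD _ _)); rewrite size_polyN size_onePX geq_max.
by rewrite size_Xalt_poly andbT.
Qed.

Lemma size_jones_poly n : (0 < n)%N -> (size (jones_poly n) <= (m * n).+1)%N.
Proof.
move=> n0.
have expb (p : {poly F}) d t : (size p <= d.+1)%N -> (size (p ^+ t)%R <= (d * t).+1)%N.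
  move=> sp; apply: (leq_trans (size_poly_exp_leq _ _)).
  by rewrite ltnS leq_mul2r; apply/orP; right; case: (size p) sp.
have hb t : (size (hook_coef 1 ('X * alt_poly) (- (1 + 'X)) t)%R <= m * t)%N.
  elim: t => [|t IH] /=; first by rewrite size_poly0.
  rewrite !mul1r (_ : - (1 + 'X) + _ = - jones_base); last by rewrite /jones_base; ring.
  apply: (leq_trans (size_polyD _ _)); rewrite geq_max; apply/andP; split.
    apply: (leq_trans (size_polyMleq _ _)); rewrite size_polyN.
    have := size_jones_base; rewrite mulnS.
    by move: (size jones_base) (size _) (m * t)%N IH => x y z; lia.
  by apply: (leq_trans (expb _ _ t size_Xalt_poly)); rewrite mulnS /m; lia.
apply: (leq_trans (size_polyD _ _)); rewrite size_polyN geq_max; apply/andP; split.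
  by apply: (leq_trans (hb n)).
apply: (leq_trans (size_polyMleq _ _)); rewrite size_polyXn.
have h1 : (size ((1 + 'X) * alt_poly ^+ n)%R <= (k.*2 * n).+2)%N.
  apply: (leq_trans (size_polyMleq _ _)); rewrite size_onePX /=.
  by apply: (expb _ k.*2); exact: size_alt_poly.
by move: h1; rewrite /m mulSn; move: (size _) (k.*2 * n)%N => x y; lia.
Qed.

Lemma jones_base0 : jones_base.[0] = 1.
Proof. by rewrite /jones_base !(hornerD, hornerN, hornerM, hornerX, hornerC) mul0r subr0 addr0. Qed.

(** For [1 < n] the error term in [jones_poly_mul] vanishes at 0. *)
Lemma jones_poly0 n : (1 < n)%N -> (jones_poly n).[0] = - (-1) ^+ n.
Proof.
move=> n1; move: (jones_poly_mul (ltnW n1)) jones_base0.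
move: (jones_poly n) jones_base alt_poly => V B C /(congr1 (fun p => p.[0])).
rewrite !(hornerM, hornerD, hornerN, horner_exp, hornerX, hornerC) => + B0.
rewrite B0 addr0 mulN1r expr0n.
by case: n n1 => [|[|n]] // _ /= /esym; rewrite !mul0r addr0 => ->; rewrite opprK.
Qed.

End JonesPoly.

(** * Power sums of inverse roots *)

Section PowerSums.
Variable F : fieldType.
Implicit Types (bs : seq F) (p : {poly F}).

(* Polynomials with constant coefficient 1 are described by the inverses of
   their roots. *)
Definition recip_prod bs : {poly F} := \prod_(b <- bs) (1 - b *: 'X).

(** A truncation of the sum of [b X / (1 - b X)], the generating function of the power sums. *)
Definition power_sum_poly N bs : {poly F} :=
  \sum_(b <- bs) \sum_(i < N) b ^+ i.+1 *: 'X^(i.+1).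

Lemma recip_prod0 bs : (recip_prod bs).[0] = 1.
Proof.
rewrite horner_prod big1 // => b _.
by rewrite !(hornerD, hornerN, hornerZ, hornerX, hornerC) mulr0 subr0.
Qed.

Lemma dvdp_newton N bs : 'X^(N.+1) %|
  'X * (recip_prod bs)^`() + recip_prod bs * power_sum_poly N bs.
Proof.
elim: bs => [|b bs IH].
  by rewrite /recip_prod /power_sum_poly !big_nil derivC !mulr0 addr0 dvdp0.
rewrite /recip_prod /power_sum_poly !big_cons -/(recip_prod bs) -/(power_sum_poly N bs).
set Q := recip_prod bs in IH *; set S := power_sum_poly N bs in IH *.
set G := \sum_(i < N) _.
have GE : (1 - b *: 'X) * G = b *: 'X - b ^+ N.+1 *: 'X^(N.+1).
  rewrite /G; elim: N {IH S G} => [|N IH]; first by rewrite big_ord0 mulr0 !expr1 subrr.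
  rewrite big_ord_recr mulrDr IH mulrBl mul1r -scalerAl -scalerAr -exprS scalerA -exprS.
  by rewrite addrA subrK.
have -> : 'X * ((1 - b *: 'X) * Q)^`() + (1 - b *: 'X) * Q * (G + S) =
    (1 - b *: 'X) * ('X * Q^`() + Q * S) - b ^+ N.+1 *: 'X^(N.+1) * Q.
  have -> : (1 - b *: 'X) * Q * (G + S) =
     Q * ((1 - b *: 'X) * G) + (1 - b *: 'X) * Q * S by ring.
  rewrite GE derivM derivB derivZ derivX -[1]/(1%:P) derivC sub0r.
  rewrite -!mul_polyC; ring.
apply: dvdp_sub; first exact: dvdp_mull.
by apply: dvdp_mulr; rewrite -mul_polyC dvdp_mull.
Qed.

Lemma power_sums_eq M bs1 bs2 : 'X^(M.+1) %| recip_prod bs1 - recip_prod bs2 ->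
  forall i, (i < M)%N ->
  \sum_(b <- bs1) b ^+ i.+1 = \sum_(b <- bs2) b ^+ i.+1.
Proof.
set Q1 := recip_prod bs1; set Q2 := recip_prod bs2 => dQ.
set S1 := power_sum_poly M bs1; set S2 := power_sum_poly M bs2.
have dS : 'X^(M.+1) %| S1 - S2.
  have cop : coprimep ('X^(M.+1)) Q1.
    apply: coprimep_expl; rewrite coprimep_sym coprimepX rootE recip_prod0.
    exact: oner_neq0.
  rewrite -(Gauss_dvdpr _ cop).
  (* The derivative loses one power of [X], which the factor [X] restores. *)
  have dD : 'X^(M.+1) %| 'X * (Q1^`() - Q2^`()).
    rewrite -derivB; case/dvdpP: dQ => r ->.
    rewrite derivM derivXn mulrDr dvdp_addr; last by rewrite mulrCA dvdp_mull // dvdp_mull.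
    by rewrite mulrCA mulrnAr -exprS dvdp_mull // -mulr_natr dvdp_mulr.
  have := dvdp_sub (dvdp_sub (dvdp_newton M bs1) (dvdp_newton M bs2)) dD.
  rewrite -/Q1 -/Q2 -/S1 -/S2 => /dvdp_sub /(_ (dvdp_mull S2 dQ)) H.
  by move: H; congr (_ %| _); ring.
have szS bs : (size (power_sum_poly M bs) <= M.+1)%N.
  apply: (leq_trans (size_sum _ _ _)); apply/bigmax_leqP_seq => b _ _.
  apply: (leq_trans (size_sum _ _ _)); apply/bigmax_leqP => i _.
  by apply: (leq_trans (size_scale_leq _ _)); rewrite size_polyXn ltnS.
have S12 : S1 = S2.
  apply/eqP; rewrite -subr_eq0; apply/negPn/negP => nz.
  have := dvdp_leq nz dS; rewrite size_polyXn leqNgt ltnS.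
  by rewrite (leq_trans (size_polyD _ _)) // size_polyN geq_max !szS.
move=> i lt_iM.
have cS bs : (power_sum_poly M bs)`_i.+1 = \sum_(b <- bs) b ^+ i.+1.
  rewrite coef_sum; apply: eq_bigr => b _; rewrite coef_sum.
  rewrite (bigD1 (Ordinal lt_iM)) //= coefZ coefXn eqxx mulr1 big1 ?addr0 // => j nj.
  rewrite coefZ coefXn eqSS; case: eqP => [E|]; last by rewrite mulr0.
  by case/eqP: nj; apply: val_inj.
by rewrite -!cS -/S1 -/S2 S12.
Qed.

(** The condition [P.[0] = 0] removes the zeroth power sum, so the two lists may differ in
    length. *)
Lemma sum_horner_eq M bs1 bs2 (P : {poly F}) :
  'X^(M.+1) %| recip_prod bs1 - recip_prod bs2 -> P.[0] = 0 -> (size P <= M.+1)%N ->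
  \sum_(b <- bs1) P.[b] = \sum_(b <- bs2) P.[b].
Proof.
move=> /power_sums_eq E P0 sP.
have HE bs : \sum_(b <- bs) P.[b] = \sum_(i < M) P`_i.+1 * \sum_(b <- bs) b ^+ i.+1.
  under [RHS]eq_bigr => i _ do rewrite mulr_sumr.
  rewrite exchange_big /=; apply: eq_bigr => b _.
  rewrite (horner_coef_wide _ sP) big_ord_recl /= -horner_coef0 P0 mul0r add0r.
  by apply: eq_bigr.
by rewrite !HE; apply: eq_bigr => i _; rewrite E.
Qed.

Lemma recip_prod_flatten n bs : recip_prod (flatten (nseq n bs)) = recip_prod bs ^+ n.
Proof.
elim: n => [|n IH] /=; first by rewrite /recip_prod big_nil.
by rewrite /recip_prod big_cat /= -/(recip_prod _) -/(recip_prod _) IH exprS.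
Qed.

Lemma sum_flatten n bs (f : F -> F) :
  \sum_(b <- flatten (nseq n bs)) f b = n%:R * \sum_(b <- bs) f b.
Proof.
elim: n => [|n IH] /=; first by rewrite big_nil mul0r.
by rewrite big_cat /= IH -natr1 mulrDl mul1r addrC.
Qed.

End PowerSums.

Lemma recip_prod_factor (F : closedFieldType) (p : {poly F}) : p.[0] != 0 ->
  {bs : seq F | p = p.[0] *: recip_prod bs & size p = (size bs).+1 /\ {in bs, forall b, b != 0}}.
Proof.
move=> p0; have [rs pE] := closed_field_poly_normal p.
have lc : lead_coef p != 0.
  by apply: contraNneq p0 => lc; rewrite pE lc scale0r horner0.
have rs0 : {in rs, forall z, z != 0}.
  move=> z zrs; apply: contraNneq p0 => z0; rewrite pE hornerZ horner_prod.
  by rewrite (big_rem z) //= hornerXsubC z0 subrr mul0r mulr0.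
exists [seq z^-1 | z <- rs].
  have E : \prod_(z <- rs) ('X - z%:P) =
      (\prod_(z <- rs) (- z)) *: recip_prod [seq z^-1 | z <- rs].
    rewrite /recip_prod big_map -scaler_prod; apply: eq_big_seq => z zrs.
    by rewrite scalerBr scalerA mulNr divff ?rs0 // scaleN1r opprK scaleNr addrC alg_polyC.
  by rewrite {1}pE E scalerA {2}pE hornerZ E hornerZ recip_prod0 mulr1.
split; first by rewrite {1}pE size_scale // size_prod_XsubC size_map.
by move=> _ /mapP[z zrs ->]; rewrite invr_eq0 rs0.
Qed.

(** * Growth of the inverse roots outside the unit disc *)

Section Growth.
Variable R : realType.
Local Notation C := R[i].
Local Notation rc := (real_complex R).
Local Notation normc := (@Normc.normc R).

Lemma normc_ge0 (z : C) : 0 <= normc z.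
Proof. by case: z => a b; exact: sqrtr_ge0. Qed.

Lemma normc_real (x : R) : normc (rc x) = `|x|.
Proof. by rewrite /Normc.normc /= expr0n /= addr0 sqrtr_sqr. Qed.

Lemma normc_prod (I : Type) (s : seq I) (P : pred I) (f : I -> C) :
  normc (\prod_(i <- s | P i) f i) = \prod_(i <- s | P i) normc (f i).
Proof. exact: (big_morph normc (@Normc.normcM R) (Normc.normc1 R)). Qed.

Lemma normcX (z : C) n : normc (z ^+ n) = normc z ^+ n.
Proof.
elim: n => [|n IH]; first by rewrite !expr0 Normc.normc1.
by rewrite !exprS Normc.normcM IH.
Qed.

Lemma normcB_le (x y : C) : normc (x - y) <= normc x + normc y.
Proof. by rewrite -[normc y]normcN; exact: le_normcD. Qed.

Lemma normc_sum (I : Type) (s : seq I) (f : I -> C) :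
  normc (\sum_(i <- s) f i) <= \sum_(i <- s) normc (f i).
Proof.
elim: s => [|i s IH]; first by rewrite !big_nil Normc.normc0.
by rewrite !big_cons (le_trans (le_normcD _ _)) // lerD2l.
Qed.

Lemma normc_gt0 (z : C) : z != 0 -> 0 < normc z.
Proof.
move=> z0; rewrite lt0r normc_ge0 andbT; apply: contraNneq z0.
by move=> /Normc.eq0_normc ->.
Qed.

(** The Mahler measure of [1 - z X]. *)
Definition capped (z : C) : R := Num.max 1 (normc z).

Lemma capped_ge1 z : 1 <= capped z. Proof. by rewrite le_max lexx. Qed.
Lemma capped_ge z : normc z <= capped z. Proof. by rewrite le_max lexx orbT. Qed.

Lemma normcX_unbounded (g : C) (e B : R) : 1 < normc g -> 0 < e ->
  exists2 J, (0 < J)%N & B <= normc g ^+ J * e.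
Proof.
move=> g1 e0; pose h := normc g - 1.
have h0 : 0 < h by rewrite subr_gt0.
have bern J : 1 + J%:R * h <= normc g ^+ J.
  elim: J => [|J IH]; first by rewrite mul0r addr0 expr0.
  rewrite exprS -natr1; have J0 : 0 <= J%:R :> R by [].
  have -> : normc g = 1 + h by rewrite /h; ring.
  by move: IH; rewrite (_ : normc g = 1 + h); [nra | rewrite /h; ring].
exists (Num.bound (B / e / h)).+1 => //.
rewrite -ler_pdivrMr // (le_trans _ (bern _)) //.
have [le0|gt0] := leP (B / e / h) 0.
  apply: (@le_trans _ _ 0); last by rewrite addr_ge0 ?mulr_ge0 // ltW.
  by rewrite -(pmulr_lle0 _ (_ : 0 < h^-1)) // invr_gt0.
have := archi_boundP (ltW gt0); rewrite ltr_pdivrMr // => lt.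
rewrite (le_trans (ltW lt)) // -natr1 mulrDl mul1r; lra.
Qed.

(** The intermediate value theorem on [[1, 2]] gives a real root above 1, hence an inverse root of
    modulus below 1. The moduli of all inverse roots multiply to that of the leading coefficient -1,
    so another one exceeds 1. *)
Lemma jones_base_expanding k (ws : seq C) : (0 < k)%N ->
  jones_base C k = recip_prod ws -> {in ws, forall g, g != 0} -> exists2 g, g \in ws & 1 < normc g.
Proof.
move=> k0 wE ws0; pose m := k.*2.+1.
have [x x1 rx] : exists2 x : R, 1 < x & 1 + x + x ^+ 2 - x ^+ m.+1 = 0.
  pose p : {poly R} := 'X^(m.+1) - 1 - 'X - 'X^2.
  have pE x : p.[x] = x ^+ m.+1 - 1 - x - x ^+ 2.
    by rewrite /p !(hornerD, hornerN, hornerXn, hornerX, hornerC).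
  have [||x /andP[x1 _] /poly.rootP rx] := @poly_ivt _ p 1 2 _ _; first by rewrite ler1n.
    rewrite !pE !expr1n; apply/andP; split; first by lra.
    have : (2 : R) ^+ 4 <= 2 ^+ m.+1 by rewrite ler_eXn2l ?ltr1n // /m; lia.
    by rewrite !exprS expr0; lra.
  rewrite pE in rx; exists x; last by rewrite -oppr0 -rx; ring.
  rewrite lt_neqAle x1 andbT; apply/eqP => x1'.
  by move: rx; rewrite -x1' !expr1n; lra.
have b0 : (jones_base C k).[(rc x)] = 0.
  move: (jones_base_mul C k); move: (jones_base C k) => B.
  move=> /(congr1 (fun p => p.[rc x])) /eqP.
  rewrite -/m !(hornerXn, hornerD, hornerN, hornerM, hornerX, hornerC).
  have -> : 1 + (rc x) + (rc x) ^+ 2 - (rc x) ^+ m.+1 = 0 :> C.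
    by rewrite -!rmorphXn -(rmorph1 rc) -!rmorphD -rmorphB rx rmorph0.
  rewrite mulf_eq0 => /orP[|/eqP //].
  rewrite -(rmorph1 rc) -rmorphD fmorph_eq0 => /eqP x0.
  by exfalso; move: x0; lra.
have [g1 g1ws ng1] : exists2 g, g \in ws & normc g < 1.
  move/eqP: b0; rewrite wE horner_prod prodf_seq_eq0 => /hasP[g gws /andP[_]].
  rewrite !(hornerD, hornerN, hornerZ, hornerX, hornerC) subr_eq0 => /eqP E.
  exists g => //; have := congr1 normc E.
  rewrite Normc.normc1 Normc.normcM normc_real gtr0_norm; last by lra.
  by have := normc_ge0 g; nra.
have prod1 : \prod_(g <- ws) normc g = 1.
  have sz1 : size (1 + 'X : {poly C}) = 2%N by exact: size_onePX.
  have lb : lead_coef (jones_base C k) = -1.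
    have := congr1 lead_coef (jones_base_mul C k); rewrite lead_coefM.
    rewrite (_ : lead_coef (1 + 'X) = 1); last by rewrite /lead_coef sz1 coefD coefX coef1 add0r.
    rewrite mul1r => ->; rewrite lead_coefDr; first by rewrite lead_coefN lead_coefXn.
    rewrite size_polyN size_polyXn.
    apply: (leq_ltn_trans (size_polyD _ _)); rewrite sz1 size_polyXn; lia.
  have := congr1 normc lb; rewrite wE lead_coef_prod normc_prod normcN Normc.normc1.
  move=> E; rewrite -[RHS]E; apply: eq_big_seq => g /ws0 g0; rewrite lead_coefDr.
    by rewrite lead_coefN lead_coefZ lead_coefX mulr1 normcN.
  by rewrite size_poly1 size_polyN size_scale // size_polyX.
apply: contrapT => no; have le1 g : g \in ws -> normc g <= 1.
  by move=> gws; rewrite leNgt; apply/negP => lt; apply: no; exists g.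
have : \prod_(g <- ws) normc g < 1.
  rewrite (big_rem g1) //= (le_lt_trans _ ng1) // ler_piMr ?normc_ge0 //.
  by rewrite big_seq; apply: prodr_ile1 => g /mem_rem gws; rewrite normc_ge0 le1.
by rewrite prod1 ltxx.
Qed.


Lemma prod_dist_le (x : C) (vs : seq C) :
  \prod_(z <- vs) normc (x - z) <=
  \prod_(z <- vs) (1 + normc z) * capped x ^+ size vs.
Proof.
have cap0 : 0 <= capped x by rewrite (le_trans ler01) ?capped_ge1.
elim: vs => [|z vs IH]; first by rewrite !big_nil expr0 mulr1.
rewrite !big_cons /= exprS mulrACA ler_pM ?normc_ge0 //.
  by apply: prodr_ge0 => y _; exact: normc_ge0.
rewrite (le_trans (normcB_le _ _)) // mulrDl mul1r lerD ?capped_ge //.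
by rewrite ler_peMr ?normc_ge0 ?capped_ge1.
Qed.

(** The test polynomial [P] vanishes at every inverse root of [jones_base] other than [g], so its
    sum over [n] copies of [ws] has modulus at least [n] times that of [P.[g]]. This is also the sum
    over [-1 :: bs], where [P] is at most [K * capped b ^+ D] with [D] the degree of [P]. *)
Lemma jones_poly_capped_growth k : (0 < k)%N -> exists D : nat,
  forall n (bs : seq C), (D.+2 < n)%N ->
  jones_poly C k n = (jones_poly C k n).[0] *: recip_prod bs ->
  (size bs <= k.*2.+1 * n)%N ->
  n%:R <= \sum_(b <- bs) (capped b ^+ D - 1).
Proof.
move=> k0; pose m := k.*2.+1.
have b0 : (jones_base C k).[0] != 0 by rewrite jones_base0 oner_neq0.
have [ws wE [_ ws0]] := recip_prod_factor b0.
rewrite jones_base0 scale1r in wE.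
have [g gws g1] := jones_base_expanding k0 wE ws0.
pose vs := [seq z <- ws | z != g].
pose K := \prod_(z <- vs) (1 + normc z).
have K0 : 0 < K by apply: prodr_gt0 => z _; rewrite ltr_wpDr ?normc_ge0.
pose e := normc (\prod_(z <- vs) (g - z)).
have e0 : 0 < e.
  apply: normc_gt0; rewrite prodf_seq_neq0; apply/allP => z.
  by rewrite mem_filter subr_eq0 eq_sym => /andP[].
(* In [m + 2], the [m] pays for subtracting 1 at each of at most [m n] inverse roots, and the 2
   leaves [n] after the extra inverse root -1 is discounted. *)
have [J J0 JB] := normcX_unbounded (K * (m%:R + 2)) g1 e0.
exists (J + size vs)%N => n bs lt_n vE sz.
pose P : {poly C} := 'X^J * \prod_(z <- vs) ('X - z%:P).
have PE x : P.[x] = x ^+ J * \prod_(z <- vs) (x - z).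
  rewrite /P hornerM hornerXn horner_prod; congr (_ * _).
  by apply: eq_bigr => z _; rewrite hornerXsubC.
have P0 : P.[0] = 0 by rewrite PE expr0n -[J]prednK // mul0r.
have sP : (size P <= n.-2.+1)%N.
  apply: (leq_trans (size_polyMleq _ _)); rewrite size_polyXn size_prod_XsubC; lia.
have Pg : K * (m%:R + 2) <= normc P.[g].
  by rewrite PE Normc.normcM normcX.
have Pb x : normc P.[x] <= K * capped x ^+ (J + size vs).
  rewrite PE Normc.normcM normcX normc_prod exprD mulrCA ler_pM ?exprn_ge0 ?normc_ge0 //.
  - by apply: prodr_ge0 => z _; exact: normc_ge0.
  - by rewrite lerXn2r ?nnegrE ?normc_ge0 ?capped_ge // (le_trans ler01) ?capped_ge1.
  exact: prod_dist_le.
(* The additional inverse root -1 stands for the factor [1 + X] of [jones_poly_mul]. *)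
have dv : 'X^(n.-2.+1) %| recip_prod (-1 :: bs) - recip_prod (flatten (nseq n ws)).
  have n0 : (0 < n)%N by lia.
  have n2 : n.-2.+1 = n.-1 by lia.
  rewrite recip_prod_flatten -wE /recip_prod big_cons -/(recip_prod bs) scaleN1r opprK n2.
  have := jones_poly_mul C k n0; rewrite vE jones_poly0 ?(leq_trans _ lt_n) //.
  move: (recip_prod bs) (jones_base C k) (alt_poly C k) => Q B A E.
  have -> : (1 + 'X) * Q - B ^+ n = 'X^(n.-1) * ((-1) ^+ n * (A ^+ n * (1 + 'X + 'X^2))).
    have sg : ((-1) ^+ n * (-1) ^+ n = 1 :> {poly C}) by rewrite -expr2 sqrr_sign.
    move: E; rewrite [(- B) ^+ n]exprNn -mul_polyC polyCN polyC_exp polyCN => E.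
    have E2 : (-1) ^+ n * (- (1 + 'X) * (- (-1) ^+ n * Q)) = (-1) ^+ n *
       ((-1) ^+ n * B ^+ n + 'X^(n.-1) * A ^+ n * (1 + 'X + 'X^2)).
      by rewrite -E.
    have E3 : (-1) ^+ n * (-1) ^+ n * ((1 + 'X) * Q) = (-1) ^+ n * (-1) ^+ n * B ^+ n +
       'X^(n.-1) * ((-1) ^+ n * (A ^+ n * (1 + 'X + 'X^2))).
      by apply: etrans (etrans E2 _); ring.
    by rewrite sg !mul1r in E3; rewrite E3 [B ^+ n + _]addrC addrK.
  by rewrite dvdp_mulr.
have := sum_horner_eq dv P0 sP.
rewrite sum_flatten big_cons => E.
have Ews : \sum_(z <- ws) P.[z] = (count_mem g ws)%:R * P.[g].
  rewrite -sum1_count natr_sum mulr_suml [RHS]big_mkcond; apply: eq_big_seq => z zws /=.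
  case: eqVneq => [->|zg]; first by rewrite mul1r.
  rewrite PE (_ : \prod_(y <- vs) (z - y) = 0) ?mulr0 //.
  apply/eqP; rewrite prodf_seq_eq0; apply/hasP; exists z; last by rewrite subrr eqxx.
  by rewrite mem_filter zg.
have normc_nat (a : nat) : normc a%:R = a%:R by rewrite normcMn Normc.normc1.
have bound : n%:R * normc P.[g] <= K * (1 + \sum_(b <- bs) capped b ^+ (J + size vs)).
  have := congr1 normc E; rewrite Ews !Normc.normcM !normc_nat => E'.
  apply: (@le_trans _ _ (n%:R * ((count_mem g ws)%:R * normc P.[g]))).
    rewrite ler_wpM2l // ler_peMl ?normc_ge0 // ler1n -has_count.
    by apply/hasP; exists g => /=.
  rewrite -E' (le_trans (le_normcD _ _)) // mulrDr lerD //.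
    have := Pb (-1); rewrite {1}/capped normcN Normc.normc1.
    by rewrite maxxx expr1n.
  rewrite (le_trans (normc_sum _ _)) // mulr_sumr ler_sum // => b _.
have {bound} bound : n%:R * (m%:R + 2) <= 1 + \sum_(b <- bs) capped b ^+ (J + size vs).
  rewrite -(ler_pM2l K0) (le_trans _ bound) // mulrCA ler_wpM2l //.
rewrite sumrB big_const_seq count_predT iter_addr addr0.
have szR : (size bs)%:R <= m%:R * n%:R :> R by rewrite -natrM ler_nat.
have n1 : 1 <= n%:R :> R by rewrite ler1n (leq_trans _ lt_n).
by move: bound szR n1; rewrite mulrDr [n%:R * m%:R]mulrC; lra.
Qed.

(** If the sum were below [T], every [ln (capped b)] would be too, and [capped b ^+ D - 1] would be
    at most a constant times [ln (capped b)]. The sum in [jones_poly_capped_growth] would then be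
    bounded independently of [n]. *)
Lemma sum_ln_capped_unbounded k (T : R) : (0 < k)%N -> exists n0 : nat,
  forall n (bs : seq C), (n0 < n)%N ->
  jones_poly C k n = (jones_poly C k n).[0] *: recip_prod bs ->
  (size bs <= k.*2.+1 * n)%N ->
  T <= \sum_(b <- bs) ln (capped b).
Proof.
move=> k0; have [D HD] := jones_poly_capped_growth k0.
have cap0 b : 0 < capped b by rewrite (lt_le_trans ltr01) ?capped_ge1.
pose T' := Num.max T 0; pose B := T' * (D%:R * expR (D%:R * T')).
exists (D.+2 + Num.bound B)%N => n bs lt_n vE sz.
rewrite leNgt; apply/negP => ltT.
have Dn : (D.+2 < n)%N by apply: leq_ltn_trans lt_n; rewrite leq_addr.
have ln0 b : 0 <= ln (capped b) by rewrite ln_ge0 // capped_ge1.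
have le_each b : b \in bs -> ln (capped b) <= T'.
  move=> bbs; rewrite le_max (le_trans _ (ltW ltT)) //.
  by rewrite (big_rem b) //= lerDl sumr_ge0.
have term b : b \in bs ->
    capped b ^+ D - 1 <= ln (capped b) * (D%:R * expR (D%:R * T')).
  move=> bbs; set y := D%:R * ln (capped b).
  have -> : capped b ^+ D = expR y by rewrite expRM_natl lnK // posrE.
  have y0 : 0 <= y by rewrite mulr_ge0.
  have yT : expR y <= expR (D%:R * T') by rewrite ler_expR ler_wpM2l // le_each.
  have : 1 - y <= expR (- y) by exact: expR_ge1Dx.
  rewrite expRN => h; have ey := expR_gt0 y.
  (* Rearranged, this is [exp y - 1 <= y exp y]. *)
  have : expR y * (1 - y) <= 1 by rewrite -[leRHS](mulfV (lt0r_neq0 ey)) ler_wpM2l // ltW.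
  move=> h2; apply: (@le_trans _ _ (y * expR y)); first by lra.
  by rewrite mulrA [ln _ * _]mulrC -/y ler_wpM2l.
have := HD n bs Dn vE sz; apply/negP; rewrite -ltNge.
apply: (@le_lt_trans _ _ B).
  rewrite big_seq; apply: (le_trans (ler_sum _ term)).
  rewrite -mulr_suml -big_seq ler_wpM2r ?mulr_ge0 ?expR_ge0 //.
  by rewrite le_max (ltW ltT).
have [B0|B0] := leP B 0; first by rewrite (le_lt_trans B0) // ltr0n; lia.
by rewrite (lt_trans (archi_boundP (ltW B0))) // ltr_nat; lia.
Qed.

End Growth.

(** * Jensen's inequality *)

Section Circle.
Variable R : realType.
Local Notation C := R[i].
Local Notation normc := (@Normc.normc R).

Definition cis (x : R) : C := Complex (cos x) (sin x).

Lemma cis0 : cis 0 = 1. Proof. by rewrite /cis cos0 sin0. Qed.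

Lemma cisD x y : cis (x + y) = cis x * cis y.
Proof.
rewrite /cis cosD sinD; apply/eqP; rewrite eq_complex /=.
by apply/andP; split; apply/eqP; ring.
Qed.

Lemma cisX x n : cis x ^+ n = cis (n%:R * x).
Proof.
elim: n => [|n IH]; first by rewrite expr0 mul0r cis0.
by rewrite exprS IH -cisD -natr1 mulrDl mul1r addrC.
Qed.

Lemma normc_cis x : normc (cis x) = 1.
Proof. by rewrite /Normc.normc /= cos2Dsin2 sqrtr1. Qed.

(** The sign is that of [A^4] for [A = e^(- i pi t / 2)]. *)
Definition circle_pt (t : R) : C := cis (- (2 * pi * t)).

Lemma circle_ptD s t : circle_pt (s + t) = circle_pt s * circle_pt t.
Proof. by rewrite -cisD; congr cis; ring. Qed.

Lemma circle_ptX t n : circle_pt t ^+ n = circle_pt (n%:R * t).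
Proof. by rewrite cisX; congr cis; ring. Qed.

Lemma circle_pt1 : circle_pt 1 = 1.
Proof.
rewrite /circle_pt /cis cosN sinN mulr1 mulr_natl cos2pi sin2pi.
by rewrite oppr0.
Qed.

Lemma circle_pt_half : circle_pt 2^-1 = -1.
Proof.
rewrite /circle_pt /cis cosN sinN mulrAC divff // mul1r cospi sinpi oppr0.
by apply/eqP; rewrite eq_complex /= oppr0 !eqxx.
Qed.

(** A smaller power equal to 1 would give [cos (2 y) = 1] with [y] strictly between 0 and [pi],
    where [sin y] is positive. *)
Lemma circle_pt_prim N : N.+1.-primitive_root (circle_pt N.+1%:R^-1).
Proof.
apply/andP; split => //; apply/forallP => i /=; rewrite unity_rootE circle_ptX.
have [->|ne] := eqVneq i.+1 N.+1; first by rewrite divff ?circle_pt1 ?eqxx.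
apply/eqP/negbTE/negP => /eqP /(congr1 (@complex.Re R)) /=; rewrite cosN => E.
have lt : (i.+1 < N.+1)%N by rewrite ltn_neqAle ne ltn_ord.
pose y : R := pi * (i.+1%:R / N.+1%:R).
have y0 : 0 < sin y.
  apply: sin_gt0_pi; rewrite /y; apply/andP; split.
    by rewrite mulr_gt0 ?pi_gt0 ?divr_gt0.
  by rewrite gtr_pMr ?pi_gt0 // ltr_pdivrMr // mul1r ltr_nat.
have : cos (y *+ 2) = 1 by rewrite -E; congr cos; rewrite /y -mulr_natl; ring.
rewrite cos_mulr2n => h.
have := cos2Dsin2 y; nra.
Qed.

Definition dist_factor (b : C) (t : R) : R := normc (1 - b * circle_pt t).

(* Of the two choices [1 - b^N] and [1 + b^N] the larger one has modulus at
   least [max 1 |b|^N]. *)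
Definition sample_shift (b : C) (N : nat) : bool :=
  normc (1 - b ^+ N) < normc (1 + b ^+ N).

(** [circle_pt] maps these points to the [N]-th roots of 1, or of -1 after the half-step shift. *)
Definition sample (b : C) (N j : nat) : R :=
  (j%:R + (sample_shift b N)%:R / 2) / N%:R.

(** The product of [1 - b z] over the [N]-th roots [z] of 1 or -1 is [1 - b^N] or [1 + b^N]. The two
    moduli add up to at least 2 and to at least [2 |b|^N], so the larger one dominates both 1 and
    [|b|^N]. *)
Lemma sample_prod (b : C) (N : nat) : (0 < N)%N ->
  capped b ^+ N <= \prod_(j < N) dist_factor b (sample b N j).
Proof.
case: N => // N _; set M := N.+1.
pose y := b * circle_pt ((sample_shift b M)%:R / 2 / M%:R).
have MR : M%:R != 0 :> R by rewrite pnatr_eq0.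
have -> : \prod_(j < M) dist_factor b (sample b M j) = normc (1 - y ^+ M).
  rewrite -normc_prod; congr normc.
  transitivity (\prod_(j < M) (1 - y * circle_pt M%:R^-1 ^+ j)).
    apply: eq_bigr => j _; rewrite /sample mulrDl circle_ptD circle_ptX /y.
    by rewrite mulrA mulrAC.
  (* The factorisation of [X^M - 1] is evaluated at [y^-1], which needs [y] nonzero. *)
  have [->|y0] := eqVneq y 0.
    by rewrite expr0n subr0 big1 // => j _; rewrite mul0r subr0.
  have := congr1 (fun p => p.[y^-1]) (factor_Xn_sub_1 (circle_pt_prim N)).
  have -> : ('X^M - 1 : {poly C}).[y^-1] = y^-1 ^+ M - 1.
    by rewrite hornerD hornerN hornerXn hornerC.
  rewrite big_mkord horner_prod => E.
  transitivity (y ^+ M * \prod_(j < M) ('X - (circle_pt M%:R^-1 ^+ j)%:P).[y^-1]).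
    rewrite -[M in y ^+ M]card_ord -prodr_const -big_split; apply: eq_bigr => j _ /=.
    by rewrite hornerXsubC mulrBr divff.
  by rewrite E mulrBr mulr1 exprVn divff // expf_neq0.
have -> : y ^+ M = b ^+ M * (if sample_shift b M then -1 else 1).
  rewrite exprMn circle_ptX mulrCA divff // mulr1.
  by case: sample_shift; rewrite ?mul1r ?circle_pt_half // mul0r /circle_pt mulr0 oppr0 cis0.
have capE : capped b ^+ M = Num.max 1 (normc (b ^+ M)).
  rewrite /capped normcX; case: (leP 1 (normc b)) => h.
    by rewrite max_r // exprn_ege1.
  by rewrite expr1n max_l // exprn_ile1 ?normc_ge0 // ltW.
set z := b ^+ M in capE *; rewrite capE.
have h1 : 2 <= normc (1 - z) + normc (1 + z).
  have := le_normcD (1 - z) (1 + z).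
  by rewrite (_ : 1 - z + (1 + z) = 1 *+ 2); [rewrite normcMn Normc.normc1|ring].
have h2 : 2 * normc z <= normc (1 - z) + normc (1 + z).
  have := normcB_le (1 + z) (1 - z).
  rewrite (_ : 1 + z - (1 - z) = z *+ 2); last by ring.
  by rewrite normcMn mulr_natl addrC.
rewrite /sample_shift -/z; case: ltP => h; rewrite ?mulrN1 ?mulr1 ?opprK ge_max;
  by apply/andP; split; lra.
Qed.

Lemma dist_factor_ge0 b t : 0 <= dist_factor b t. Proof. exact: normc_ge0. Qed.

Lemma dist_factor_le b t : dist_factor b t <= 1 + normc b.
Proof.
rewrite (le_trans (normcB_le _ _)) // Normc.normc1 Normc.normcM normc_cis mulr1.
by rewrite lexx.
Qed.

(** The product over all samples is at least 1, so no sample hits a zero. *)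
Lemma sample_gt0 b N j : (j < N)%N -> 0 < dist_factor b (sample b N j).
Proof.
move=> ltj; rewrite lt0r dist_factor_ge0 andbT; apply/eqP => E.
have := sample_prod b (leq_ltn_trans (leq0n j) ltj).
rewrite (bigD1 (Ordinal ltj)) //= E mul0r leNgt exprn_gt0 //.
by rewrite (lt_le_trans ltr01) ?capped_ge1.
Qed.

Lemma ln_prod (I : eqType) (s : seq I) (f : I -> R) : {in s, forall i, 0 < f i} ->
  ln (\prod_(i <- s) f i) = \sum_(i <- s) ln (f i).
Proof.
elim: s => [|i s IH] f0; first by rewrite !big_nil ln1.
have fi0 : 0 < f i by apply: f0; rewrite inE eqxx.
have fs0 j : j \in s -> 0 < f j by move=> js; apply: f0; rewrite inE js orbT.
rewrite !big_cons lnM ?posrE ?IH // big_seq_cond; apply: prodr_gt0 => j.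
by rewrite andbT => /fs0.
Qed.

Lemma continuous_dist_factor b : continuous (dist_factor b).
Proof.
have -> : dist_factor b = Num.sqrt \o (fun t =>
    (1 - (complex.Re b * cos (- (2 * pi * t)) - complex.Im b * sin (- (2 * pi * t)))) *
    (1 - (complex.Re b * cos (- (2 * pi * t)) - complex.Im b * sin (- (2 * pi * t)))) +
    (complex.Re b * sin (- (2 * pi * t)) + complex.Im b * cos (- (2 * pi * t))) *
    (complex.Re b * sin (- (2 * pi * t)) + complex.Im b * cos (- (2 * pi * t)))).
  apply/funext => t; rewrite /dist_factor /circle_pt /cis /Normc.normc; case: b => x y /=.
  by rewrite !expr2 sub0r mulrNN.
move=> t; apply: continuous_comp; last exact: sqrt_continuous.
have cl : {for t, continuous (fun t : R => - (2 * pi * t))}.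
  by apply: cvgN; apply: cvgMr; exact: cvg_id.
have cc : {for t, continuous (fun t : R => cos (- (2 * pi * t)))}.
  by apply: (continuous_comp cl); exact: continuous_cos.
have cs : {for t, continuous (fun t : R => sin (- (2 * pi * t)))}.
  by apply: (continuous_comp cl); exact: continuous_sin.
have c1 : {for t, continuous (fun t : R =>
    1 - (complex.Re b * cos (- (2 * pi * t)) - complex.Im b * sin (- (2 * pi * t))))}.
  by apply: cvgB; [exact: cvg_cst|apply: cvgB; apply: cvgMr].
have c2 : {for t, continuous (fun t : R =>
    complex.Re b * sin (- (2 * pi * t)) + complex.Im b * cos (- (2 * pi * t)))}.
  by apply: cvgD; apply: cvgMr.
by apply: cvgD; apply: cvgM.
Qed.

Section Jensen.
Local Open Scope classical_set_scope.
Variable bs : seq C.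
Local Notation mu := (@lebesgue_measure R).

Definition root_prod (t : R) : R := \prod_(b <- bs) dist_factor b t.

Let D : set R := `[0%R, 1%R[.
Let mD : measurable D. Proof. exact: measurable_itv. Qed.
(** An upper bound of [ln (dist_factor b t)]; it makes [G] and its sampled step functions [H N]
    nonnegative, as Fatou's lemma requires. *)
Let Cb (b : C) : R := ln (1 + normc b).
Let Ctot : R := \sum_(b <- bs) Cb b.
Let G (t : R) : R := Ctot - ln (root_prod t).
Let cell (N j : nat) : set R := `[j%:R / N.+1%:R, j.+1%:R / N.+1%:R[.
Let v (N : nat) (b : C) (j : nat) : R := Cb b - ln (dist_factor b (sample b N.+1 j)).
Let H (N : nat) (t : R) : R :=
  \sum_(b <- bs) \sum_(j < N.+1) v N b j * \1_(cell N j) t.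

Let Cb_ge0 b : 0 <= Cb b.
Proof. by rewrite ln_ge0 // lerDl normc_ge0. Qed.

Let mcell N j : measurable (cell N j). Proof. exact: measurable_itv. Qed.

Let v_ge0 N b j : (j < N.+1)%N -> 0 <= v N b j.
Proof.
move=> ltj; rewrite subr_ge0 ler_ln ?dist_factor_le // posrE ?sample_gt0 //.
by rewrite ltr_wpDr ?normc_ge0.
Qed.

Let G_ge0 t : 0 <= G t.
Proof.
rewrite subr_ge0; have [le0|gt0] := leP (root_prod t) 0.
  by rewrite ln0 // sumr_ge0.
rewrite /Ctot -ln_prod; last by move=> b _; rewrite ltr_wpDr ?normc_ge0.
rewrite ler_ln ?posrE //; last by apply: prodr_gt0 => b _; rewrite ltr_wpDr ?normc_ge0.
by apply: ler_prod => b _; rewrite dist_factor_ge0 dist_factor_le.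
Qed.

Let measurable_root_prod : measurable_fun setT root_prod.
Proof.
apply: measurable_prod => b _; apply: continuous_measurable_fun.
exact: continuous_dist_factor.
Qed.

Let mG : measurable_fun setT G.
Proof.
apply: measurable_funB; first exact: measurable_cst.
by apply: measurableT_comp => //; exact: measurable_ln.
Qed.

Let mterm N b j : measurable_fun setT (fun t => v N b j * \1_(cell N j) t).
Proof. by apply: measurable_funM; [exact: measurable_cst|exact: measurable_indic]. Qed.

Let mH N : measurable_fun setT (H N).
Proof. by apply: measurable_sum => b; apply: measurable_sum => j. Qed.

Let H_ge0 N t : 0 <= H N t.
Proof.
by apply: sumr_ge0 => b _; apply: sumr_ge0 => j _; rewrite mulr_ge0 ?v_ge0.
Qed.

Let cell_measure N j : (j < N.+1)%N -> mu (cell N j `&` D) = (N.+1%:R^-1)%:E.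
Proof.
move=> ltj; have -> : cell N j `&` D = cell N j.
  apply: setIidl => t; rewrite /cell /D /= !in_itv /= => /andP[h1 h2]; apply/andP; split.
    by rewrite (le_trans _ h1) // divr_ge0.
  by rewrite (lt_le_trans h2) // ler_pdivrMr // mul1r ler_nat.
rewrite lebesgue_measure_itv /= lte_fin ltr_pM2r ?invr_gt0 // ltr_nat ltnSn.
by rewrite -EFinB -mulrBl -natrB // subSnn mul1r.
Qed.

(** All cells have equal length, so the integral averages the sampled values. The average of the
    logarithms is [ln] of the product in [sample_prod] divided by [N.+1], hence at least
    [ln (capped b)]. *)
Let H_integral N :
  (\int[mu]_(t in D) (H N t)%:E <= (\sum_(b <- bs) (Cb b - ln (capped b)))%:E)%E.
Proof.
have -> : (\int[mu]_(t in D) (H N t)%:E =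
    \sum_(b <- bs) \sum_(j < N.+1) (v N b j / N.+1%:R)%:E)%E.
  under eq_integral => t _ do rewrite -sumEFin.
  rewrite ge0_integral_sum //; last 2 first.
  - move=> b; apply/measurable_EFinP; apply: measurable_funTS.
    apply: measurable_sum => j. exact: mterm.
  - by move=> b t _; rewrite lee_fin sumr_ge0 // => j _; rewrite mulr_ge0 ?v_ge0.
  apply: eq_bigr => b _.
  under eq_integral => t _ do rewrite -sumEFin.
  rewrite ge0_integral_sum //; last 2 first.
  - by move=> j; apply/measurable_EFinP; apply: measurable_funTS; exact: mterm.
  - by move=> j t _; rewrite lee_fin mulr_ge0 ?v_ge0.
  apply: eq_bigr => j _; under eq_integral => t _ do rewrite EFinM.
  rewrite ge0_integralZl_EFin ?v_ge0 //; last first.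
    by apply/measurable_EFinP; apply: measurable_funTS; apply: measurable_indic; exact: mcell.
  rewrite EFinM; congr (_ * _)%E.
  exact: etrans (integral_indic mu mD (mcell N j)) (cell_measure (ltn_ord j)).
under eq_bigr => b _ do rewrite sumEFin.
rewrite sumEFin lee_fin; apply: ler_sum => b _.
rewrite -mulr_suml sumrB sumr_const card_ord ler_pdivrMr // mulrBl mulr_natr lerB //.
rewrite -ln_prod; last by move=> j _; exact: sample_gt0.
rewrite mulr_natr -lnXn; last by rewrite (lt_le_trans ltr01) ?capped_ge1.
have cap_gt0 : 0 < capped b ^+ N.+1.
  by rewrite exprn_gt0 // (lt_le_trans ltr01) ?capped_ge1.
have sp := sample_prod b (ltn0Sn N).
by rewrite ler_ln ?posrE // (lt_le_trans cap_gt0).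
Qed.

(** The index of the cell that contains [t]. *)
Let pos (N : nat) (t : R) : nat := Num.truncn (t * N.+1%:R).

Let H_at N t : D t -> (pos N t < N.+1)%N /\
  H N t = Ctot - ln (\prod_(b <- bs) dist_factor b (sample b N.+1 (pos N t))).
Proof.
rewrite /D /= in_itv /= => /andP[t0 t1].
have tN0 : 0 <= t * N.+1%:R by rewrite mulr_ge0.
have /andP[lo hi] := truncn_itv tN0; rewrite -/(pos N t) in lo hi.
have ltp : (pos N t < N.+1)%N.
  rewrite -(ltr_nat R) (le_lt_trans lo) // gtr_pMl //.
split => //; rewrite ln_prod; last by move=> b _; exact: sample_gt0.
rewrite -sumrB; apply: eq_bigr => b _.
rewrite (bigD1 (Ordinal ltp)) //= indicE mem_set ?mulr1; last first.
  by rewrite /cell /= in_itv /= ler_pdivrMr // lo ltr_pdivlMr.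
rewrite big1 ?addr0 // => j jp; rewrite indicE memNset ?mulr0 //.
rewrite /cell /= in_itv /= ler_pdivrMr // ltr_pdivlMr // => /andP[h1 h2].
case/eqP: jp; apply: val_inj => /=; apply/eqP; rewrite eqn_leq.
by apply/andP; split; rewrite -ltnS -(ltr_nat R) ?(le_lt_trans h1 hi) ?(le_lt_trans lo h2).
Qed.

(** The sample lies in the closure of the cell of [t], whose width is [harmonic N]. *)
Let sample_cvg b t : D t -> sample b N.+1 (pos N t) @[N --> \oo] --> t.
Proof.
move=> Dt; have t0 : 0 <= t by move: Dt; rewrite /D /= in_itv /= => /andP[].
apply: (@squeeze_cvgr _ _ _ _ (fun N => t - harmonic N) (fun N => t + harmonic N)).
- apply: nearW => N; rewrite /harmonic /sample.
  have /andP[lo hi] := truncn_itv (mulr_ge0 t0 (ler0n R N.+1)).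
  rewrite -/(pos N t) in lo hi; rewrite -natr1 in hi.
  have N0 : 0 < N.+1%:R :> R by [].
  rewrite ler_pdivlMr // ler_pdivrMr // mulrBl mulrDl mulVf ?gt_eqF //.
  by case: (sample_shift b N.+1) => /=; apply/andP; split; lra.
- rewrite -[X in _ --> X]subr0; apply: cvgB; first exact: cvg_cst.
  exact: cvg_harmonic.
- rewrite -[X in _ --> X]addr0; apply: cvgD; first exact: cvg_cst.
  exact: cvg_harmonic.
Qed.

Let prod_cvg t : D t ->
  \prod_(b <- bs) dist_factor b (sample b N.+1 (pos N t)) @[N --> \oo] --> root_prod t.
Proof.
move=> Dt; rewrite /root_prod; elim: bs => [|b s IH].
  by under eq_fun do rewrite big_nil; rewrite big_nil; exact: cvg_cst.
under eq_fun do rewrite big_cons; rewrite big_cons; apply: cvgM => //.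
by apply: continuous_cvg; [exact: continuous_dist_factor|exact: sample_cvg].
Qed.

(* Truncating [H N] at [G] makes it converge to [G] even at the zeros of
   [root_prod], where [G] takes the junk value [Ctot]. *)
Let min_cvg t : D t -> (Num.min (H N t) (G t))%:E @[N --> \oo] --> (G t)%:E.
Proof.
move=> Dt; have pc := prod_cvg Dt; apply: cvg_EFin; first exact: nearW.
have [gt0|le0] := ltP 0 (root_prod t).
  have HG : H N t @[N --> \oo] --> G t.
    under eq_fun => N do rewrite (H_at N Dt).2.
    apply: cvgB; first exact: cvg_cst.
    by apply: continuous_cvg pc; exact: continuous_ln.
  apply: (@squeeze_cvgr _ _ _ _ (fun N => G t - `|H N t - G t|) (fun=> G t)).
  - apply: nearW => N; rewrite ge_min lexx orbT andbT le_min gerDl oppr_le0 normr_ge0.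
    by rewrite andbT lerBlDr -lerBlDl distrC ler_norm.
  - rewrite -[X in _ --> X]subr0; apply: cvgB; first exact: cvg_cst.
    by rewrite -(normr0 R) -(subrr (G t)); apply: cvg_norm; apply: cvgB => //; exact: cvg_cst.
  - exact: cvg_cst.
apply: cvg_near_cst.
(* At a zero of [root_prod] the sampled product is eventually below 1. Then [H N t] is at least
   [Ctot], which is [G t] since [ln 0 = 0], and the minimum equals [G t]. *)
have : \forall N \near \oo, \prod_(b <- bs) dist_factor b (sample b N.+1 (pos N t)) < 1.
  by apply: cvgr_lt pc _ _; rewrite (le_lt_trans le0).
apply: filterS => N lt1; rewrite /= min_r // (H_at N Dt).2 /G (ln0 le0) lerD2l lerN2.
by rewrite ln_le0 // ltW.
Qed.

(** Fatou's lemma for the minima of [H N] and [G], which converge to [G] everywhere on [D] and have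
    integrals at most those of [H N]. *)
Let G_integral :
  (\int[mu]_(t in D) (G t)%:E <= (\sum_(b <- bs) (Cb b - ln (capped b)))%:E)%E.
Proof.
have mK N : measurable_fun D (fun t => (Num.min (H N t) (G t))%:E).
  by apply/measurable_EFinP; apply: measurable_funTS; apply: measurable_minr.
have := fatou mu mD mK.
under eq_integral => t /set_mem Dt do rewrite (cvg_limn_einf_sup (min_cvg Dt)).1.
move=> h; apply: (le_trans (h _)).
  by move=> N t _; rewrite lee_fin le_min H_ge0 G_ge0.
rewrite limn_einf_lim; apply: lime_le; first exact: is_cvg_einfs.
apply: nearW => N; apply: (@le_trans _ _ (\int[mu]_(t in D) (Num.min (H N t) (G t))%:E)%E).
  by apply: ereal_inf_lbound; exists N => /=.
apply: (le_trans _ (H_integral N)); apply: ge0_le_integral => //.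
- by move=> t _; rewrite lee_fin le_min H_ge0 G_ge0.
- exact: mK.
- by apply/measurable_EFinP; apply: measurable_funTS; exact: mH.
- by move=> t _; rewrite lee_fin ge_min lexx.
Qed.

Lemma jensen_lower_bound :
  ((\sum_(b <- bs) ln (capped b))%:E <=
   \int[mu]_(t in `[0%R, 1%R]) (ln (root_prod t))%:E)%E.
Proof.
(* The half-open interval is the one tiled by the cells. *)
rewrite -integral_itv_bndo_bndc; last first.
  apply/measurable_EFinP; apply: measurable_funTS.
  by apply: measurableT_comp => //; exact: measurable_ln.
rewrite -/D.
have muD : mu D = 1%E by rewrite lebesgue_measure_itv /= lte_fin ltr01 oppr0 adde0.
have iG : mu.-integrable D (EFin \o G).
  apply/integrableP; split; first by apply/measurable_EFinP; apply: measurable_funTS; exact: mG.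
  under eq_integral => t _ do rewrite /= ger0_norm ?G_ge0 //.
  by rewrite (le_lt_trans G_integral) // ltry.
have muDlt : (mu D < +oo)%E by rewrite muD ltry.
have iC : mu.-integrable D (EFin \o cst Ctot).
  apply: measurable_bounded_integrable; [exact: mD|exact: muDlt|exact: measurable_cst|].
  exact: bounded_cst.
have -> : (\int[mu]_(t in D) (ln (root_prod t))%:E =
    \int[mu]_(t in D) ((cst Ctot t)%:E - (G t)%:E))%E.
  by apply: eq_integral => t _; rewrite -EFinB /G opprB addrC subrK.
rewrite integralB_EFin; [|exact: mD|exact: iC|exact: iG].
have -> : (\int[mu]_(t in D) (cst Ctot t)%:E = Ctot%:E)%E.
  apply: etrans (integral_cst mu mD Ctot%:E) _.
  exact: etrans (congr1 (fun x => Ctot%:E * x)%E muD) (mule1 _).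
rewrite leeBrDr //; last first.
  by apply: integrable_fin_num.
rewrite (le_trans (leeD2l _ G_integral)) // -EFinD lee_fin sumrB.
by rewrite /Ctot addrC subrK.
Qed.

End Jensen.
End Circle.

(** * Mahler measure of the pretzel links *)

Lemma normc_jones_on_circle (R : realType) (k n : nat) (t : R) : (0 < n)%N ->
  Normc.normc (jones_on_circle (pretzel n k) t) =
  Normc.normc (jones_poly R[i] k n).[circle_pt t].
Proof.
move=> n0; rewrite /jones_on_circle -[Complex _ _]/(cis _); set A := cis _.
have nA : Normc.normc A = 1 by exact: normc_cis.
have A0 : A != 0.
  by apply: contra_eq_neq nA => ->; rewrite Normc.normc0 eq_sym oner_neq0.
have nX (z : R[i]) (j : int) : Normc.normc z = 1 -> Normc.normc (z ^ j) = 1.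
  by move=> z1; case: j => j; rewrite /exprz ?Normc.normcV normcX z1 expr1n ?invr1.
(* The writhe factor and the monomial in [A] have modulus 1. *)
rewrite /jonesA kbracket_jones_poly // !Normc.normcM nX; last first.
  by rewrite normcN normcX nA expr1n.
rewrite mul1r !normcX Normc.normcM !Normc.normcV !normcX !Normc.normcV nA.
rewrite invr1 !expr1n invr1 !(mul1r, expr1n).
congr (Normc.normc (_.[_])); rewrite /A cisX /circle_pt; congr cis.
by field.
Qed.

Local Open Scope classical_set_scope.
Unset Implicit Arguments.

Theorem theorem4p1 (R : realType) (k : nat) : (1 <= k)%N ->
  (fun n : nat => mahler_jones R (pretzel n k)) @ \oo --> +oo%E.
Proof.
move=> k0; apply/cvgeyPge => T.
have [n0 Hn0] := sum_ln_capped_unbounded T k0.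
(* Besides [n0 < n], the offset 2 ensures [1 < n] for [jones_poly0]. *)
exists (n0 + 2)%N => // n /= le_n.
have n1 : (1 < n)%N by apply: leq_trans le_n; rewrite leq_addl.
have n_gt0 := ltnW n1.
pose v := jones_poly R[i] k n.
have v0 : v.[0] = - (-1) ^+ n by exact: jones_poly0.
have v0n : Normc.normc v.[0] = 1.
  by rewrite v0 normcN normcX normcN Normc.normc1 expr1n.
have v0nz : v.[0] != 0 by rewrite v0 oppr_eq0 signr_eq0.
have [bs vE [szv _]] := recip_prod_factor v0nz.
have sz : (size bs <= k.*2.+1 * n)%N.
  by rewrite -ltnS -szv; exact: size_jones_poly.
have LT : T <= \sum_(b <- bs) ln (capped b).
  by apply: Hn0 vE sz; apply: leq_trans le_n; rewrite addn2 ltnW.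
(* The constant coefficient of [v] has modulus 1, so on the circle only the inverse roots
   contribute. *)
have intE t : Normc.normc (jones_on_circle (pretzel n k) t) = root_prod bs t.
  rewrite normc_jones_on_circle // -/v vE hornerZ Normc.normcM v0n mul1r.
  rewrite /recip_prod horner_prod normc_prod; apply: eq_bigr => b _.
  by rewrite !(hornerD, hornerN, hornerZ, hornerX, hornerC).
rewrite /mahler_jones.
under eq_integral => t _ do rewrite intE.
(* The bound on the logarithm suffices because [T <= 1 + T <= exp T]. *)
apply: (@le_trans _ _ (expeR T%:E)); first by rewrite /= lee_fin (le_trans _ (expR_ge1Dx T)) // lerDr.
rewrite lee_expeR; apply: le_trans (jensen_lower_bound bs).
by rewrite lee_fin.
Qed.
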